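(* Consider LTL separation: given finite sets $\mathit{P}$ and $\mathit{N}$ of lassos over a finite alphabet $\Sigma$ and a regular tree grammar $\mathcal{G}$ over syntax trees of LTL formulas over $\Sigma$, synthesize a formula $\varphi\in L(\mathcal{G})$ with $uv^\omega\models\varphi$ for all $(u,v)\in\mathit{P}$ and $uv^\omega\not\models\varphi$ for all $(u,v)\in\mathit{N}$, or declare none exists. This problem is decidable in time $\mathcal{O}(2^{\mathrm{poly}(mn)}\cdot|\mathcal{G}|)$, where $m=|\mathit{P}|+|\mathit{N}|$ and $n=\max_{(u,v)\in\mathit{P}\cup\mathit{N}}|uv|$.
   Context: A lasso is a pair $(u,v)$ of finite words over $\Sigma$ (with $v$ nonempty) representing the infinite periodic word $uv^\omega$. LTL formulas: $\varphi::=a\in\Sigma\mid\varphi\wedge\varphi'\mid\varphi\vee\varphi'\mid\neg\varphi\mid\mathsf{X}\varphi\mid\varphi\,\mathsf{U}\,\varphi'$, with the standard semantics over infinite words (where the atom $a$ holds at a position iff the letter there is $a$), represented as syntax trees over the corresponding ranked alphabet. $L(\mathcal{G})$ is the tree language of the regular tree grammar $\mathcal{G}$ and $|\mathcal{G}|$ its size. *)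

(* Defs.v *)
From Stdlib Require Import Relation_Operators.
From Stdlib Require List.
From mathcomp Require Import all_boot all_algebra.

Set Implicit Arguments.
Unset Strict Implicit.
Unset Printing Implicit Defensive.

(** * Lassos *)

Definition lasso (S : eqType) : Type := {uv : seq S * seq S | uv.2 != [::]}.

Definition stem (S : eqType) (l : lasso S) : seq S := (sval l).1.
Definition loop (S : eqType) (l : lasso S) : seq S := (sval l).2.
Definition lasso_size (S : eqType) (l : lasso S) : nat :=
  size (stem l) + size (loop l).

(* The infinite word u v^omega.  The default [x] given to [nth] is never
   returned; it exists because [v] is nonempty. *)
Definition periodic_word (S : eqType) (u v : seq S) :
    v != [::] -> nat -> S :=
  match v return v != [::] -> nat -> S with
  | [::] => fun v_nonempty => match notF v_nonempty with end
  | x :: v' => fun _ i =>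
      if i < size u then nth x u i
      else nth x (x :: v') ((i - size u) %% size (x :: v'))
  end.

Definition lasso_word (S : eqType) (l : lasso S) : nat -> S :=
  @periodic_word S (stem l) (loop l) (svalP l).

(** * LTL *)

(* Syntax trees over the ranked alphabet consisting of the elements of [A]
   (rank 0), [And], [Or], [Until] (rank 2), and [Not], [Next] (rank 1). *)
Inductive ltl (A : Type) : Type :=
  | Atom of A
  | And of ltl A & ltl A
  | Or of ltl A & ltl A
  | Not of ltl A
  | Next of ltl A
  | Until of ltl A & ltl A.

Fixpoint ltl_map (A B : Type) (f : A -> B) (t : ltl A) : ltl B :=
  match t with
  | Atom a => Atom (f a)
  | And t1 t2 => And (ltl_map f t1) (ltl_map f t2)
  | Or t1 t2 => Or (ltl_map f t1) (ltl_map f t2)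
  | Not t1 => Not (ltl_map f t1)
  | Next t1 => Next (ltl_map f t1)
  | Until t1 t2 => Until (ltl_map f t1) (ltl_map f t2)
  end.

Fixpoint ltl_size (A : Type) (t : ltl A) : nat :=
  match t with
  | Atom _ => 1
  | And t1 t2 | Or t1 t2 | Until t1 t2 => (ltl_size t1 + ltl_size t2).+1
  | Not t1 | Next t1 => (ltl_size t1).+1
  end.

Fixpoint sat (S : Type) (w : nat -> S) (i : nat) (phi : ltl S) : Prop :=
  match phi with
  | Atom a => w i = a
  | And p q => sat w i p /\ sat w i q
  | Or p q => sat w i p \/ sat w i q
  | Not p => ~ sat w i p
  | Next p => sat w i.+1 p
  | Until p q =>
      exists j, [/\ i <= j, sat w j q & forall k, i <= k < j -> sat w k p]
  end.

Definition models (S : eqType) (l : lasso S) (phi : ltl S) : Prop :=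
  sat (lasso_word l) 0 phi.

(** * Regular tree grammars *)

(* A sentential form is a tree whose leaves are letters ([inl]) or
   nonterminals ([inr]).  Right-hand sides are arbitrary sentential forms.
   The finite set of productions is given by a list. *)
Record grammar (S Nt : finType) := Grammar {
  start : Nt;
  productions : seq (Nt * ltl (S + Nt)) }.

Inductive rewrites (S Nt : finType) (G : grammar S Nt) :
    ltl (S + Nt) -> ltl (S + Nt) -> Prop :=
  | rw_production X t : List.In (X, t) (productions G) ->
      rewrites G (Atom (inr X)) t
  | rw_And_l t1 t1' t2 : rewrites G t1 t1' ->
      rewrites G (And t1 t2) (And t1' t2)
  | rw_And_r t1 t2 t2' : rewrites G t2 t2' ->
      rewrites G (And t1 t2) (And t1 t2')
  | rw_Or_l t1 t1' t2 : rewrites G t1 t1' ->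
      rewrites G (Or t1 t2) (Or t1' t2)
  | rw_Or_r t1 t2 t2' : rewrites G t2 t2' ->
      rewrites G (Or t1 t2) (Or t1 t2')
  | rw_Not t1 t1' : rewrites G t1 t1' ->
      rewrites G (Not t1) (Not t1')
  | rw_Next t1 t1' : rewrites G t1 t1' ->
      rewrites G (Next t1) (Next t1')
  | rw_Until_l t1 t1' t2 : rewrites G t1 t1' ->
      rewrites G (Until t1 t2) (Until t1' t2)
  | rw_Until_r t1 t2 t2' : rewrites G t2 t2' ->
      rewrites G (Until t1 t2) (Until t1 t2').

Definition lang (S Nt : finType) (G : grammar S Nt) (phi : ltl S) : Prop :=
  clos_refl_trans _ (rewrites G)
    (Atom (inr (start G))) (ltl_map inl phi).

Definition grammar_size (S Nt : finType) (G : grammar S Nt) : nat :=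
  #|Nt| + \sum_(r <- productions G) (ltl_size r.2).+1.

(** * LTL separation *)

Definition separates (S : finType) (P N : seq (lasso S)) (phi : ltl S) : Prop :=
  (forall l, l \in P -> models l phi) /\
  (forall l, l \in N -> ~ models l phi).

(* [None] is the answer "no such formula exists". *)
Definition correct_answer (S Nt : finType) (P N : seq (lasso S))
    (G : grammar S Nt) (answer : option (ltl S)) : Prop :=
  match answer with
  | Some phi => lang G phi /\ separates P N phi
  | None => forall phi, lang G phi -> ~ separates P N phi
  end.

(** * Random access machines

   The uniform-cost RAM with addition and truncated subtraction (no
   multiplication, division or bit operations), with structured control flow.
   A program is a fixed finite piece of syntax; it can mention finitely many
   registers and has an unbounded, indirectly addressed memory. *)

Inductive expr : Type :=
  | Const of nat
  | Reg of nat
  | Mem of expr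
  | Plus of expr & expr
  | Minus of expr & expr.

Inductive prog : Type :=
  | Skip
  | SetReg of nat & expr
  | SetMem of expr & expr
  | Seq of prog & prog
  | If of expr & prog & prog
  | While of expr & prog.

Record state := State { reg : nat -> nat; mem : nat -> nat }.

Definition update (f : nat -> nat) (i x : nat) : nat -> nat :=
  fun j => if j == i then x else f j.

Fixpoint eval (s : state) (e : expr) : nat :=
  match e with
  | Const c => c
  | Reg r => reg s r
  | Mem e1 => mem s (eval s e1)
  | Plus e1 e2 => eval s e1 + eval s e2
  | Minus e1 e2 => eval s e1 - eval s e2
  end.

Fixpoint cost (e : expr) : nat :=
  match e with
  | Const _ | Reg _ => 1
  | Mem e1 => (cost e1).+1
  | Plus e1 e2 | Minus e1 e2 => (cost e1 + cost e2).+1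
  end.

(* [exec c s s' t]: started in state [s], the program [c] halts in state [s']
   after [t] elementary steps.  Tests succeed on nonzero values. *)
Inductive exec : prog -> state -> state -> nat -> Prop :=
  | exec_Skip s : exec Skip s s 1
  | exec_SetReg s r e :
      exec (SetReg r e) s (State (update (reg s) r (eval s e)) (mem s))
        (cost e).+1
  | exec_SetMem s e1 e2 :
      exec (SetMem e1 e2) s
        (State (reg s) (update (mem s) (eval s e1) (eval s e2)))
        (cost e1 + cost e2).+1
  | exec_Seq c1 c2 s s' s'' t1 t2 :
      exec c1 s s' t1 -> exec c2 s' s'' t2 ->
      exec (Seq c1 c2) s s'' (t1 + t2)
  | exec_If_true e c1 c2 s s' t :
      eval s e != 0 -> exec c1 s s' t ->
      exec (If e c1 c2) s s' (cost e + t).+1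
  | exec_If_false e c1 c2 s s' t :
      eval s e = 0 -> exec c2 s s' t ->
      exec (If e c1 c2) s s' (cost e + t).+1
  | exec_While_true e c s s' s'' t1 t2 :
      eval s e != 0 -> exec c s s' t1 -> exec (While e c) s' s'' t2 ->
      exec (While e c) s s'' (cost e + t1 + t2).+1
  | exec_While_false e c s :
      eval s e = 0 ->
      exec (While e c) s s (cost e).+1.

(* The input occupies the memory cells 0, 1, ...; everything else is 0. *)
Definition initial (input : seq nat) : state :=
  State (fun _ => 0) (fun i => nth 0 input i).

(** * Input and output conventions *)

(* Letters and nonterminals are represented by their rank in the enumeration
   of their type, words by their length followed by their letters. *)
Definition encode_word (S : finType) (w : seq S) : seq nat :=
  size w :: [seq nat_of_ord (enum_rank a) | a <- w].

Definition encode_lasso (S : finType) (l : lasso S) : seq nat :=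
  encode_word (stem l) ++ encode_word (loop l).

(* Postfix notation, two memory cells per tree node. *)
Fixpoint encode_tree (S Nt : finType) (t : ltl (S + Nt)) : seq nat :=
  match t with
  | Atom (inl a) => [:: 0; nat_of_ord (enum_rank a)]
  | And t1 t2 => encode_tree t1 ++ encode_tree t2 ++ [:: 1; 0]
  | Or t1 t2 => encode_tree t1 ++ encode_tree t2 ++ [:: 2; 0]
  | Not t1 => encode_tree t1 ++ [:: 3; 0]
  | Next t1 => encode_tree t1 ++ [:: 4; 0]
  | Until t1 t2 => encode_tree t1 ++ encode_tree t2 ++ [:: 5; 0]
  | Atom (inr X) => [:: 6; nat_of_ord (enum_rank X)]
  end.

Definition encode_production (S Nt : finType) (r : Nt * ltl (S + Nt)) :
    seq nat :=
  [:: nat_of_ord (enum_rank r.1), ltl_size r.2 & encode_tree r.2].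

Definition encode_instance (S Nt : finType) (P N : seq (lasso S))
    (G : grammar S Nt) : seq nat :=
  [:: #|S|; #|Nt|; nat_of_ord (enum_rank (start G));
      size P; size N; size (productions G)]
  ++ flatten [seq encode_lasso l | l <- P]
  ++ flatten [seq encode_lasso l | l <- N]
  ++ flatten [seq encode_production r | r <- productions G].

(* [stored M a phi]: the memory [M] holds the syntax tree [phi] as a linked
   structure with root at address [a].  Subtrees may be shared: the smallest
   formula separating P from N may be exponentially larger than the grammar, so
   that no algorithm could write it out as a plain tree within the time
   bound. *)
Inductive stored (S : finType) (M : nat -> nat) : nat -> ltl S -> Prop :=
  | stored_Atom a x : M a = 0 -> M a.+1 = enum_rank x ->
      stored M a (Atom x)
  | stored_And a p q : M a = 1 -> stored M (M a.+1) p -> stored M (M a.+2) q ->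
      stored M a (And p q)
  | stored_Or a p q : M a = 2 -> stored M (M a.+1) p -> stored M (M a.+2) q ->
      stored M a (Or p q)
  | stored_Not a p : M a = 3 -> stored M (M a.+1) p ->
      stored M a (Not p)
  | stored_Next a p : M a = 4 -> stored M (M a.+1) p ->
      stored M a (Next p)
  | stored_Until a p q :
      M a = 5 -> stored M (M a.+1) p -> stored M (M a.+2) q ->
      stored M a (Until p q).

(* On halting, register 0 contains 0 for "none exists", and otherwise the
   address of the formula. *)
Definition returns (S : finType) (s : state) (answer : option (ltl S)) : Prop :=
  match answer with
  | None => reg s 0 = 0
  | Some phi => reg s 0 != 0 /\ stored (mem s) (reg s 0) phi
  end.

(* Main.v *)
Require Import Defs.
From Stdlib Require Import Relation_Operators.
From mathcomp Require Import all_boot all_algebra.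
From mathcomp Require Import zify.

Set Implicit Arguments.
Unset Strict Implicit.
Unset Printing Implicit Defensive.

(** The grammar may enter the running time only linearly, whereas any fixed power of [X = 2 ^ E] is
    affordable; so everything local to a site is done by brute force. The final power is 6: a site
    has [X] slots, each processed slot tries [X ^ 2] pairs of vectors, and computing one vector
    costs at most a constant times [X ^ 3]. [E] is the address just after the lassos, that is 6 plus
    the sum of all |u| + |v| + 2, so vectors also have bits at cells that hold no letter; those
    follow the same rules and do not affect the separation test. A witness may be too large to be
    written as a tree. Each slot keeps the node that filled it first, and the children of a node lie
    in slots filled before it; sharing is therefore acyclic and every slot unfolds to a finite
    formula. Soundness is an invariant on filled slots, each of which has a derived formula with the
    right vector. Completeness is an induction on derivations over the saturated set. *)

(* On the finitely many positions of all lassos a formula is a vector of truth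
   values, and the vector of a compound formula is computed from those of its
   immediate subformulas; with K positions in total, K linear in mn, there are
   2^K vectors.  Every node of a right-hand side and every nonterminal becomes a
   site; the vectors derivable at the sites form a least fixpoint, which a
   worklist computes.  The time stays linear in the grammar because every site
   triggers at most two rules: that of its parent node, and a copy to the next
   site of a linked chain through all occurrences of its nonterminal. *)

(** * A program logic with step counts *)

Notation memory := Defs.mem.

(** Total correctness with a time bound: halting is part of the judgement, and [B] is only an upper
    bound, so costs can be rounded up freely. *)
Definition run (c : prog) (s : state) (B : nat) (Q : state -> Prop) : Prop :=
  exists s' t, [/\ exec c s s' t, t <= B & Q s'].

Lemma run_le c s B B' Q : run c s B Q -> B <= B' -> run c s B' Q.
Proof.
by move=> [s' [t [ex le q]]] leB; exists s', t; split=> //; apply: leq_trans leB.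
Qed.

Lemma run_imp c s B (P Q : state -> Prop) :
  run c s B P -> (forall s', P s' -> Q s') -> run c s B Q.
Proof. by move=> [s' [t [ex le p]]] pq; exists s', t; split=> //; apply: pq. Qed.

Lemma run_skip s (Q : state -> Prop) : Q s -> run Skip s 1 Q.
Proof. by exists s, 1; split=> //; constructor. Qed.

Lemma run_setreg r e s (Q : state -> Prop) :
  Q (State (update (reg s) r (eval s e)) (memory s)) ->
  run (SetReg r e) s (cost e).+1 Q.
Proof. by eexists; eexists; split; [constructor| |]. Qed.

Lemma run_setmem e1 e2 s (Q : state -> Prop) :
  Q (State (reg s) (update (memory s) (eval s e1) (eval s e2))) ->
  run (SetMem e1 e2) s (cost e1 + cost e2).+1 Q.
Proof. by eexists; eexists; split; [constructor| |]. Qed.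

Lemma run_seq c1 c2 s B1 B2 Q :
  run c1 s B1 (fun s' => run c2 s' B2 Q) -> run (Seq c1 c2) s (B1 + B2) Q.
Proof.
move=> [s1 [t1 [ex1 le1 [s2 [t2 [ex2 le2 q]]]]]].
by exists s2, (t1 + t2); split=> //; [apply: exec_Seq ex1 ex2 | apply: leq_add].
Qed.

(** The bounds of the branches are added, which costs only a constant factor. A branch that cannot
    be taken can be given the bound 0. *)
Lemma run_if e c1 c2 s B1 B2 Q :
  (eval s e != 0 -> run c1 s B1 Q) -> (eval s e = 0 -> run c2 s B2 Q) ->
  run (If e c1 c2) s (cost e + (B1 + B2)).+1 Q.
Proof.
move=> H1 H2; case: (altP (eval s e =P 0)) => [e0|e1].
  have [s' [t [ex le q]]] := H2 e0.
  by exists s', (cost e + t).+1; split; [apply: exec_If_false|lia|].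
have [s' [t [ex le q]]] := H1 e1.
by exists s', (cost e + t).+1; split; [apply: exec_If_true|lia|].
Qed.

Lemma run_while_step e c s B1 B2 Q : eval s e != 0 ->
  run c s B1 (fun s' => run (While e c) s' B2 Q) ->
  run (While e c) s (B1 + (cost e).+1 + B2) Q.
Proof.
move=> e1 [s1 [t1 [ex1 le1 [s2 [t2 [ex2 le2 q]]]]]].
exists s2, (cost e + t1 + t2).+1; split=> //; last lia.
exact: exec_While_true ex1 ex2.
Qed.

Lemma run_while_done e c s (Q : state -> Prop) :
  eval s e = 0 -> Q s -> run (While e c) s (cost e).+1 Q.
Proof. by move=> e0 q; exists s, (cost e).+1; split=> //; apply: exec_While_false. Qed.

(** The index [j] bounds the remaining rounds from above and need not be 0 on exit, so a loop may
    stop early. *)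
Lemma run_while (I : nat -> state -> Prop) e c s n B (Q : state -> Prop) :
  I n s ->
  (forall j s, I j s -> eval s e = 0 -> Q s) ->
  (forall j s, I j s -> eval s e != 0 -> 0 < j /\ run c s B (I j.-1)) ->
  run (While e c) s (n * (B + (cost e).+1) + (cost e).+1) Q.
Proof.
move=> + HQ HI; elim: n s => [|n IH] s Is.
  case: (altP (eval s e =P 0)) => [e0|e1]; last by have [] := HI _ _ Is e1.
  by apply: run_le; [apply: run_while_done (HQ _ _ Is e0) | lia].
case: (altP (eval s e =P 0)) => [e0|e1].
  by apply: run_le; [apply: run_while_done (HQ _ _ Is e0) | lia].
have [_ r] := HI _ _ Is e1.
apply: run_le; first by apply: run_while_step e1 (run_imp r IH).
lia.
Qed.

(** Each list element has its own cost. The loop over the productions needs this: charging every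
    production the price of the largest would lose linearity in the grammar. *)
Lemma run_while_seq (A : Type) (I : seq A -> state -> Prop) (B : A -> nat)
    e c s l (Q : state -> Prop) :
  I l s ->
  (forall s, I [::] s -> eval s e = 0 /\ Q s) ->
  (forall x l s, I (x :: l) s -> eval s e != 0 /\ run c s (B x) (I l)) ->
  run (While e c) s (\sum_(x <- l) (B x + (cost e).+1) + (cost e).+1) Q.
Proof.
move=> + HQ HI; elim: l s => [|x l IH] s Is.
  have [e0 q] := HQ _ Is; rewrite big_nil.
  exact: run_while_done.
have [e1 r] := HI _ _ _ Is; rewrite big_cons.
apply: run_le; first by apply: run_while_step e1 (run_imp r IH).
lia.
Qed.

Declare Scope prog_scope.
Delimit Scope prog_scope with P.
Bind Scope prog_scope with prog.
Bind Scope prog_scope with expr.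
Notation "# c" := (Const c%N) (at level 1, format "# c") : prog_scope.
Notation "$ r" := (Reg r%N) (at level 1, format "$ r") : prog_scope.
Notation "@[ e ]" := (Defs.Mem e) (at level 0, e at level 99, format "@[ e ]") : prog_scope.
Notation "e1 + e2" := (Plus e1 e2) : prog_scope.
Notation "e1 - e2" := (Minus e1 e2) : prog_scope.
Notation "r <~ e" := (SetReg r%N e) (at level 70) : prog_scope.
Notation "e1 ::= e2" := (SetMem e1 e2) (at level 70) : prog_scope.
Notation "c1 ;; c2" := (Seq c1 c2) (at level 90, right associativity) : prog_scope.

Lemma updE f i x : update f i x i = x.
Proof. by rewrite /update eqxx. Qed.

Lemma updN f i x j : j != i -> update f i x j = f j.
Proof. by rewrite /update => /negbTE ->. Qed.

(* Register discipline: a routine writes only registers below a bound that grows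
   with its place in the call hierarchy, so that callers keep their data in
   higher registers. *)
Definition frame (lo : nat) (s s' : state) : Prop :=
  forall r, lo <= r -> reg s' r = reg s r.

Definition twice (e : expr) : expr := Plus e e.
(** There is no multiplication; with records of 16 cells, four nested doublings compute a record
    offset at constant cost. *)
Definition times16 (e : expr) : expr := twice (twice (twice (twice e))).

(** * Boolean vectors as numbers *)

Ltac upd := rewrite /= /update /=.
Ltac regs_at r := rewrite /update /=; repeat match goal with
  | H : frame ?lo _ ?s |- context [reg ?s r] => rewrite (H r); last lia; rewrite /=
  | |- context [r == ?i] => rewrite (_ : (r == i) = false); last lia
  end; try done.
Ltac frame_by := let r := fresh "r" in let Hr := fresh "Hr" in
  move=> r Hr; regs_at r.

Definition bit (v k : nat) : bool := odd (v %/ 2 ^ k).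

Lemma bit_out v k E : v < 2 ^ E -> E <= k -> bit v k = false.
Proof.
move=> vE Ek; rewrite /bit divn_small //; apply: leq_trans vE _.
by rewrite leq_exp2l.
Qed.

Fixpoint bits_value (f : nat -> bool) (k n : nat) : nat :=
  if n is n'.+1 then f k + 2 * bits_value f k.+1 n' else 0.

Lemma bits_value_lt f k n : bits_value f k n < 2 ^ n.
Proof.
by elim: n k => [|n IH] k //=; have := IH k.+1; rewrite expnS; case: (f k); lia.
Qed.

Lemma bit_bits_value f k n j :
  bit (bits_value f k n) j = (j < n) && f (k + j).
Proof.
rewrite /bit; elim: n k j => [|n IH] k j /=; first by rewrite div0n.
case: j => [|j] /=; first by rewrite expn0 divn1 addn0 oddD mul2n odd_double addbF oddb.
rewrite expnS divnMA; set h := bits_value _ _ _.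
have -> : (f k + 2 * h) %/ 2 = h by rewrite addnC mulnC divnMDl // divn_small ?addn0 //; case: (f k).
by rewrite IH addSnnS.
Qed.

Lemma bits_value_bit v n : v < 2 ^ n -> bits_value (bit v) 0 n = v.
Proof.
have: forall k, bits_value (bit v) k n = v %/ 2 ^ k %% 2 ^ n.
  elim: n => [|n IH] k /=; first by rewrite modn1.
  rewrite IH /bit expnSr divnMA; set x := v %/ _.
  rewrite expnS.
  have := divn_eq x 2; rewrite modn2 => Hx; rewrite [in RHS]Hx.
  set y := x %/ 2; have := divn_eq y (2 ^ n); set q := y %/ _; set r := y %% _.
  move=> Hy; have Hr : r < 2 ^ n by rewrite ltn_mod expn_gt0.
  rewrite [in RHS]Hy; have -> : (q * 2 ^ n + r) * 2 + odd x =
    q * (2 * 2 ^ n) + (odd x + 2 * r) by lia.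
  by rewrite modnMDl modn_small //; case: (odd x); lia.
by move=> -> vn; rewrite expn0 divn1 modn_small.
Qed.

(* There is no division, so bit [k] of [v] is found by reducing [v] modulo
   [2 ^ k.+1] by repeated subtraction; exponential time is affordable. *)
Definition bit_prog : prog := (
  4 <~ #1;; 5 <~ $2;;
  While ($5) (4 <~ $4 + $4;; 5 <~ $5 - #1);;
  3 <~ $1;;
  While (($3 + #1) - ($4 + $4)) (3 <~ $3 - ($4 + $4));;
  3 <~ #1 - ($4 - $3))%P.

Lemma run_bit s E : reg s 2 <= E -> reg s 1 < 2 ^ E ->
  run bit_prog s (40 * 2 ^ E) (fun s' =>
    [/\ reg s' 3 = bit (reg s 1) (reg s 2), memory s' = memory s,
        reg s' 1 = reg s 1, reg s' 2 = reg s 2 & frame 6 s s']).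
Proof.
move=> kE vX; set v := reg s 1 in vX *; set k := reg s 2 in kE *.
have EX : E < 2 ^ E by rewrite ltn_expl.
apply: run_le.
  apply: run_seq; apply: run_setreg; apply: run_seq; apply: run_setreg.
  apply: run_seq; apply: (run_imp (P := fun s' =>
    [/\ reg s' 4 = 2 ^ k, memory s' = memory s, reg s' 1 = v, reg s' 2 = k & frame 6 s s'])).
    apply: (run_while (I := fun j s' => [/\ reg s' 5 = j, j <= k,
      reg s' 4 = 2 ^ (k - j), memory s' = memory s & [/\ reg s' 1 = v, reg s' 2 = k & frame 6 s s']])
      (n := k)).
    - by split=> //; rewrite ?subnn //; split=> //; frame_by.
    - move=> j s1 [j5 jk p4 m [e1 e2 fr]] /= j0; split=> //.
      by rewrite p4 -j5 j0 subn0.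
    move=> j s1 [j5 jk p4 m [e1 e2 fr]] /= j0; split; first lia.
    apply: run_seq; apply: run_setreg; apply: run_setreg; upd; split=> //.
    - lia.
    - lia.
    - by rewrite p4 addnn -mul2n -expnS; congr (2 ^ _); lia.
    - by split=> //; frame_by.
  move=> s1 [p4 m e1 e2 fr].
  apply: run_seq; apply: run_setreg; apply: run_seq.
  apply: (run_imp (P := fun s' => [/\ reg s' 4 = 2 ^ k, reg s' 3 < 2 * 2 ^ k,
     bit (reg s' 3) k = bit v k, memory s' = memory s & [/\ reg s' 1 = v, reg s' 2 = k & frame 6 s s']])).
    (* Each subtraction lowers register 3 by a positive amount, so [v] bounds the number of rounds.
       Taking away [2 * 2 ^ k] lowers the quotient by [2 ^ k] by exactly 2 and keeps its parity,
       which is bit [k]. *)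
    apply: (run_while (I := fun j s' => [/\ reg s' 4 = 2 ^ k, reg s' 3 <= j,
     bit (reg s' 3) k = bit v k, memory s' = memory s & [/\ reg s' 1 = v, reg s' 2 = k & frame 6 s s']])
     (n := v)).
    - upd; rewrite e1; split=> //; split=> //; frame_by.
    - move=> j s2 /= [q4 q3 b m2 [f1 f2 fr2]] j0; split=> //; lia.
    move=> j s2 /= [q4 q3 b m2 [f1 f2 fr2]] j0.
    have kp : 0 < 2 ^ k by rewrite expn_gt0.
    split; first lia.
    apply: run_setreg; upd; split=> //; first lia; last by split=> //; frame_by.
    rewrite -b /bit; have {2}-> : reg s2 3 = 2 * 2 ^ k + (reg s2 3 - (reg s2 4 + reg s2 4)) by lia.
    by rewrite divnMDl ?expn_gt0 // oddD.
  move=> s2 [q4 q3 b m2 [f1 f2 fr2]].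
  apply: run_setreg; upd; split=> //; last by frame_by.
  rewrite -b /bit q4; set x := reg s2 3 in q3 *.
  case: (ltnP x (2 ^ k)) => H; first by rewrite divn_small //; lia.
  have -> : x = 1 * 2 ^ k + (x - 2 ^ k) by lia.
  rewrite divnMDl ?expn_gt0 // divn_small; last lia.
  by rewrite /=; lia.
rewrite /=; nia.
Qed.

(** * Operations on truth vectors along the successor function *)

Section Vectors.
Variables (E base : nat) (M0 J : nat -> nat).

(* Positions are the input addresses of the letters of the lassos.  The
   successor of an address is the next one except where [J] records a jump,
   from the end of the stem or of the loop to the start of the loop. *)
Definition next_pos (k : nat) : nat := if J k == 0 then k.+1 else J k.

(** The expansion law of Until, cut off after [fuel] steps. That fuel [E] loses nothing on a lasso
    is shown in [sat_bit]. *)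
Fixpoint until_bit (fuel v1 v2 k : nat) : bool :=
  if fuel is fuel'.+1 then
    bit v2 k || bit v1 k && until_bit fuel' v1 v2 (next_pos k)
  else false.

(* Operation codes are the tags of [encode_tree], except that 6 is a copy.  For
   a letter (code 0), [v1] is its rank. *)
Definition op_bit (op v1 v2 k : nat) : bool :=
  match op with
  | 0 => M0 k == v1
  | 1 => bit v1 k && bit v2 k
  | 2 => bit v1 k || bit v2 k
  | 3 => ~~ bit v1 k
  | 4 => bit v1 (next_pos k)
  | 5 => until_bit E v1 v2 k
  | _ => bit v1 k
  end.

Definition op_vector (op v1 v2 : nat) : nat :=
  bits_value (op_bit op v1 v2) 0 E.

Lemma op_vector_lt op v1 v2 : op_vector op v1 v2 < 2 ^ E.
Proof. exact: bits_value_lt. Qed.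

Lemma bit_op_vector op v1 v2 k : k < E ->
  bit (op_vector op v1 v2) k = op_bit op v1 v2 k.
Proof. by move=> kE; rewrite bit_bits_value kE. Qed.

Lemma op_vector_copy v1 v2 : v1 < 2 ^ E -> op_vector 6 v1 v2 = v1.
Proof. by move=> v1X; rewrite -[RHS](bits_value_bit v1X). Qed.

Definition globals (s : state) : Prop :=
  [/\ reg s 90 = E, reg s 91 = 2 ^ E & reg s 92 = base].

Lemma frame_globals lo s s' : lo <= 90 -> frame lo s s' -> globals s -> globals s'.
Proof. by move=> lo90 fr [g0 g1 g2]; split; rewrite fr //; lia. Qed.

Record lasso_memory (m : nat -> nat) : Prop := LassoMemory {
  lm_input : forall k, k < E -> m k = M0 k;
  lm_jump : forall k, k < E -> m (base + 16 * k + 6) = J k }.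

Hypothesis J_le : forall k, k < E -> J k <= E.

(** The value [E] itself can occur, at the end of the lasso area; [run_bit] accepts it, and vectors
    below [2 ^ E] have bit 0 there. *)
Lemma next_pos_le k : k < E -> next_pos k <= E.
Proof. by rewrite /next_pos; case: eqP => // _; apply: J_le. Qed.

Definition next_prog (r : nat) : prog :=
  (If @[$92 + times16 ($r) + #6] (r <~ @[$92 + times16 ($r) + #6]) (r <~ $r + #1))%P.

Lemma run_next r s : reg s r < E -> globals s -> lasso_memory (memory s) ->
  run (next_prog r) s 100 (fun s' =>
    [/\ reg s' r = next_pos (reg s r), memory s' = memory s &
        forall r', r' != r -> reg s' r' = reg s r']).
Proof.
move=> kE [_ _ gb] [_ mJ]; apply: run_le.
  have := mJ _ kE; set k := reg s r => Jk.
  have ad : base + (k + k + (k + k) + (k + k + (k + k)) +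
      (k + k + (k + k) + (k + k + (k + k)))) + 6 = base + 16 * k + 6 by lia.
  apply: run_if => /=; rewrite -/k gb ad Jk => Jk0; apply: run_setreg;
    rewrite /= -/k ?gb ?ad ?Jk; split=> //; rewrite /next_pos ?updE //.
  - by rewrite (negbTE Jk0).
  - by move=> r' /updN ->.
  - by rewrite Jk0 /= addn1.
  - by move=> r' /updN ->.
by [].
Qed.

Definition until_prog : prog := (
  13 <~ #0;; 14 <~ $90;; 15 <~ $12;;
  While ($14) (
    14 <~ $14 - #1;;
    1 <~ $11;; 2 <~ $15;; bit_prog;;
    If ($3) (13 <~ #1;; 14 <~ #0)
      (1 <~ $10;; bit_prog;;
       If ($3) (next_prog 15) (14 <~ #0))))%P.

Lemma run_until s : reg s 10 < 2 ^ E -> reg s 11 < 2 ^ E -> reg s 12 < E ->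
  globals s -> lasso_memory (memory s) ->
  run until_prog s (300 * 2 ^ E * 2 ^ E) (fun s' =>
    [/\ reg s' 13 = until_bit E (reg s 10) (reg s 11) (reg s 12),
        memory s' = memory s & frame 16 s s']).
Proof.
set v1 := reg s 10; set v2 := reg s 11; set k := reg s 12 => v1X v2X kE gl lm.
have EX : E < 2 ^ E by rewrite ltn_expl.
have [gE _ _] := gl.
apply: run_le.
  do 3 (apply: run_seq; apply: run_setreg).
  (* The result so far is [b], the fuel left is [f] and the current address is [j']. The program
     stops by clearing the fuel, hence [f <= j] only, and [j'] is controlled only while fuel
     remains. *)
  apply: (run_while (n := E) (I := fun j s' => exists (b : bool) f j',
    [/\ [/\ reg s' 10 = v1, reg s' 11 = v2, reg s' 13 = b & reg s' 14 = f],
     reg s' 15 = j' /\ (f != 0 -> j' <= E /\ b = false), f <= j,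
     until_bit E v1 v2 k = b || until_bit f v1 v2 j' &
     memory s' = memory s /\ frame 16 s s'])).
  - exists false, E, k; upd; rewrite gE; split=> //; first by split=> // _; split=> //; lia.
    by split=> //; frame_by.
  - move=> j s1 [b [f [j' [[e10 e11 e13 e14] [e15 _] fj H [m fr]]]]] /= f0.
    by split=> //; rewrite H e13; rewrite e14 in f0; rewrite f0 orbF.
  move=> j s1 [b [f [j' [[e10 e11 e13 e14] [e15 inv] fj H [m fr]]]]] /=.
  rewrite e14 => f0; have [j'E b0] := inv f0; split; first lia.
  case: f => // f in e14 fj H inv f0 *.
  do 3 (apply: run_seq; apply: run_setreg); upd.
  apply: run_seq; apply: (run_imp (run_bit (E := E) _ _)); rewrite /= ?e15 ?e11 //.
  move=> s2 [b3 m2 f1 f2 fr2].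
  have r2 q : 6 <= q -> reg s2 q = if q == 14 then f else reg s1 q.
    by move=> q6; rewrite fr2 //= /update e14 subn1 /=; do 2![rewrite ifF; last lia].
  have fr2' : frame 16 s s2 by move=> r Hr; rewrite r2; last lia; rewrite ifF ?fr //; lia.
  apply: run_if => /= [B|B]; rewrite b3 in B.
    apply: run_seq; apply: run_setreg; apply: run_setreg => /=.
    exists true, 0, j'; upd; rewrite !r2 //=; split=> //.
      by rewrite H b0 /=; case: bit B.
    by rewrite m2; split=> //; frame_by.
  have {}B : bit v2 j' = false by case: bit B.
  apply: run_seq; apply: run_setreg.
  apply: run_seq; apply: (run_imp (run_bit (E := E) _ _)); upd; rewrite ?f2 ?r2 //= ?e10 ?e15 //.
  move=> s3 [b3' m3 g1 g2 fr3].
  have r3 q : 6 <= q -> reg s3 q = reg s2 q by move=> q6; rewrite fr3 //= /update ifF //; lia.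
  have fr3' : frame 16 s s3 by move=> r Hr; rewrite r3 ?fr2' //; lia.
  apply: run_if => /= [C|C]; rewrite b3' in C.
    have {}C : bit v1 j' by case: bit C.
    (* A set bit of [v1] can only occur below [E], which makes reading the jump table legitimate. *)
    have lt_j' : j' < E by rewrite ltnNge; apply: contraL C => C; rewrite (bit_out v1X).
    apply: (run_imp (run_next (r := 15) _ _ _)); rewrite ?m3 ?m2 ?m //.
    - by rewrite r3 // r2 //= e15.
    - by apply: (@frame_globals 16 s).
    move=> s4 [h15 m4 fr4].
    exists false, f, (next_pos j').
    split.
    - by rewrite !fr4 //= !r3 // !r2 //= e13 b0.
    - rewrite h15 r3 // r2 //= e15; split=> // _; split=> //; exact: next_pos_le.
    - lia.
    - by rewrite H b0 /= B C.
    by rewrite m4; split=> // r Hr; rewrite fr4 ?fr3' //; lia.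
  apply: run_setreg => /=.
  exists false, 0, j'; upd; rewrite !r3 // !r2 //= e13 b0; split=> //.
    by rewrite H b0 /= B; case: bit C.
  by rewrite m3 m2; split=> //; frame_by.
rewrite /=; nia.
Qed.

(** Connectives are expressed by truncated subtraction: [1 - (1 - (x + y))] is disjunction,
    [(x + y) - 1] is conjunction, and [(a - b) + (b - a)] vanishes exactly when the two numbers
    agree. *)
Definition op_prog : prog := (
  If ($20)
    (1 <~ $10;; 2 <~ $12;; bit_prog;; 16 <~ $3;;
     1 <~ $11;; bit_prog;; 17 <~ $3;;
     If ($20 - #1)
      (If ($20 - #2)
        (If ($20 - #3)
          (If ($20 - #4)
            (If ($20 - #5) (13 <~ $16) until_prog)
            (2 <~ $12;; next_prog 2;; 1 <~ $10;; bit_prog;; 13 <~ $3))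
          (13 <~ #1 - $16))
        (13 <~ #1 - (#1 - ($16 + $17))))
      (13 <~ ($16 + $17) - #1))
    (13 <~ #1 - ((@[$12] - $10) + ($10 - @[$12]))))%P.

(** The operands are bounded only for a positive operation code: for a letter, register 10 holds its
    rank, and the alphabet may be larger than [2 ^ E]. *)
Lemma run_op s :
  (0 < reg s 20 -> reg s 10 < 2 ^ E /\ reg s 11 < 2 ^ E) -> reg s 12 < E ->
  globals s -> lasso_memory (memory s) ->
  run op_prog s (900 * 2 ^ E * 2 ^ E) (fun s' =>
    [/\ reg s' 13 = op_bit (reg s 20) (reg s 10) (reg s 11) (reg s 12),
        memory s' = memory s & frame 18 s s']).
Proof.
set v1 := reg s 10; set v2 := reg s 11; set k := reg s 12 => vX kE gl lm.
have EX : E < 2 ^ E by rewrite ltn_expl.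
apply: run_le.
  apply: run_if => /= [o0|o0]; last first.
    apply: run_setreg; upd; rewrite -/v1 -/k o0 (lm_input lm kE); split=> //=; last by frame_by.
    case: eqP => H; lia.
  have [v1X v2X] : v1 < 2 ^ E /\ v2 < 2 ^ E by apply: vX; rewrite lt0n.
  do 2 (apply: run_seq; apply: run_setreg => /=).
  apply: run_seq; apply: (run_imp (run_bit (E := E) _ _)); upd; rewrite -/k -/v1 //; first lia.
  move=> s1 [b1 m1 e1 e2 fr1].
  do 2 (apply: run_seq; apply: run_setreg => /=).
  apply: run_seq; apply: (run_imp (run_bit (E := E) _ _)); upd; rewrite ?e2 ?(fr1 11) //=; first lia.
  move=> s2 [b2 m2 f1 f2 fr2].
  apply: run_seq; apply: run_setreg => /=; upd.
  set s3 := State _ _.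
  have r3 q : 6 <= q -> q != 16 -> q != 17 -> reg s3 q = reg s q.
    by move=> *; regs_at q.
  have r16 : reg s3 16 = bit v1 k by rewrite /= fr2 //= b1.
  have r17 : reg s3 17 = bit v2 k by [].
  have m3 : memory s3 = memory s by rewrite /= m2 m1.
  have fr3 : frame 18 s s3 by move=> r Hr; apply: r3; lia.
  have gl3 : globals s3 by apply: frame_globals fr3 gl.
  move: s3 r3 r16 r17 m3 fr3 gl3 => s3 r3 r16 r17 m3 fr3 gl3.
  have Hop := r3 20 erefl erefl erefl; set op := reg s 20 in Hop o0 *; clearbody op.
  apply: run_if => /=; rewrite Hop => o1; last first.
    have -> : op = 1 by lia.
    apply: run_setreg; upd; rewrite r16 r17; split=> //=; last by frame_by.
    by case: (bit v1 k) (bit v2 k) => [] [].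
  apply: run_if => /=; rewrite Hop => o2; last first.
    have -> : op = 2 by lia.
    apply: run_setreg; upd; rewrite r16 r17; split=> //=; last by frame_by.
    by case: (bit v1 k) (bit v2 k) => [] [].
  apply: run_if => /=; rewrite Hop => o3; last first.
    have -> : op = 3 by lia.
    apply: run_setreg; upd; rewrite r16; split=> //=; last by frame_by.
    by case: (bit v1 k).
  apply: run_if => /=; rewrite Hop => o4; last first.
    have -> : op = 4 by lia.
    apply: run_seq; apply: run_setreg => /=.
    apply: run_seq; apply: (run_imp (run_next (r := 2) _ _ _)); upd; rewrite ?r3 ?m3 //.
    move=> s4 [e4 m4 fr4].
    apply: run_seq; apply: run_setreg => /=.
    apply: run_seq; apply: (run_imp (run_bit (E := E) _ _)); upd; rewrite ?e4 ?fr4 //= ?r3 //; first exact: next_pos_le.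
    move=> s5 [e5 m5 _ _ fr5].
    apply: run_setreg; upd; rewrite e5 /= m5 m4; split=> //.
    move=> r Hr; rewrite /= /update ifF; last lia.
    rewrite fr5 /= /update ?ifF; try lia.
    by rewrite fr4 /= ?ifF ?fr3 //; lia.
  apply: run_if => /=; rewrite Hop => o5; last first.
    have -> : op = 5 by lia.
    apply: (run_imp (run_until _ _ _ _ _)); rewrite ?r3 ?m3 // => s4 [e4 m4 fr4].
    by split=> //; move=> r Hr; rewrite fr4 ?fr3 //; lia.
  apply: run_setreg; upd; rewrite r16; split=> //; last by frame_by.
  by clear Hop; move: o0 o1 o2 o3 o4 o5; do 6 (case: op => [|op] //).
rewrite /=; nia.
Qed.

(** Horner's scheme from the highest bit downwards, which needs doubling but no powers of two. *)
Definition vector_prog : prog := (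
  23 <~ #0;; 24 <~ $90;;
  While ($24) (
    24 <~ $24 - #1;; 10 <~ $21;; 11 <~ $22;; 12 <~ $24;;
    op_prog;; 23 <~ ($23 + $23) + $13))%P.

Lemma run_vector s :
  (0 < reg s 20 -> reg s 21 < 2 ^ E /\ reg s 22 < 2 ^ E) ->
  globals s -> lasso_memory (memory s) ->
  run vector_prog s (1000 * 2 ^ E * 2 ^ E * 2 ^ E) (fun s' =>
    [/\ reg s' 23 = op_vector (reg s 20) (reg s 21) (reg s 22),
        memory s' = memory s, frame 25 s s' &
        forall r, 20 <= r < 23 -> reg s' r = reg s r]).
Proof.
set op := reg s 20; set v1 := reg s 21; set v2 := reg s 22 => vX gl lm.
have EX : E < 2 ^ E by rewrite ltn_expl.
have [gE _ _] := gl.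
apply: run_le.
  do 2 (apply: run_seq; apply: run_setreg => /=).
  apply: (run_while (n := E) (I := fun j s' =>
    [/\ reg s' 24 = j, j <= E, reg s' 23 = bits_value (op_bit op v1 v2) j (E - j),
      memory s' = memory s &
      forall r, 18 <= r -> r != 23 -> r != 24 -> reg s' r = reg s r])).
  - by upd; rewrite subnn; split=> // r *; rewrite /= !ifF //; lia.
  - move=> j s1 [e24 jE e23 m fr] /= j0; rewrite e24 in j0; rewrite j0 subn0 in e23.
    by split=> // r *; apply: fr; lia.
  move=> j s1 [e24 jE e23 m fr] /= j0; split; first lia.
  do 4 (apply: run_seq; apply: run_setreg => /=); upd.
  apply: run_seq; apply: (run_imp (run_op _ _ _ _)); rewrite /= ?(fr 20) ?(fr 21) ?(fr 22) //.
  - lia.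
  - by case: gl => *; split; rewrite /= fr.
  - by rewrite m.
  rewrite -/op -/v1 -/v2 => s2 [e13 m2 fr2].
  apply: run_setreg; upd; rewrite fr2 //= fr2 //=; split=> //.
  - lia.
  - lia.
  - rewrite e23 e13 (_ : E - j.-1 = (E - j).+1); last lia.
    rewrite /= (_ : j.-1.+1 = j); last lia.
    by rewrite e24 subn1; lia.
  - by rewrite m2.
  move=> r *; rewrite ifF; last lia.
  rewrite fr2 //= !ifF; try lia.
  exact: fr.
rewrite /=; nia.
Qed.

End Vectors.

Definition holds_at (M : nat -> nat) (a : nat) (w : seq nat) : Prop :=
  forall i, i < size w -> M (a + i) = nth 0 w i.

Lemma holds_at_cat M a w1 w2 : holds_at M a (w1 ++ w2) <->
  holds_at M a w1 /\ holds_at M (a + size w1) w2.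
Proof.
split=> [H|[H1 H2] i].
  split=> i Hi; first by rewrite H ?nth_cat ?Hi // size_cat; lia.
  by rewrite -addnA H ?nth_cat ?size_cat; [rewrite ifF; [congr nth|]; lia|lia].
rewrite size_cat nth_cat => Hi; case: ltnP => H; first exact: H1.
by rewrite -H2 ?size_cat; [congr M; lia|lia].
Qed.

Lemma holds_at_cons M a x w : holds_at M a (x :: w) <->
  M a = x /\ holds_at M (a + 1) w.
Proof.
rewrite -cat1s holds_at_cat /=; split=> -[H1 H2]; split=> //.
  by have := H1 0 erefl; rewrite addn0.
by case=> [|i] //; rewrite addn0.
Qed.

(** * The lassos in the input *)

Section Lassos.
Variable (S : finType).
Implicit Types (l : lasso S) (ls : seq (lasso S)).

Definition code_size l : nat := lasso_size l + 2.
Definition total_size ls : nat := \sum_(l <- ls) code_size l.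

Lemma size_encode_lasso l : size (encode_lasso l) = code_size l.
Proof.
rewrite /encode_lasso /encode_word size_cat /= !size_map /code_size /lasso_size.
by rewrite addSn addnS addn2.
Qed.

Definition encode_lassos ls : seq nat := flatten [seq encode_lasso l | l <- ls].

Lemma encode_lassos_cons l ls :
  encode_lassos (l :: ls) = encode_lasso l ++ encode_lassos ls.
Proof. by []. Qed.

Lemma size_encode_lassos ls : size (encode_lassos ls) = total_size ls.
Proof.
rewrite /total_size; elim: ls => [|l ls IH]; first by rewrite big_nil.
by rewrite encode_lassos_cons size_cat IH big_cons size_encode_lasso.
Qed.

Lemma loop_size l : 0 < size (loop l).
Proof. by rewrite /loop; case: l => [[u [|x v]]]. Qed.

Lemma encode_lasso_holds M b l : holds_at M b (encode_lasso l) ->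
  [/\ M b = size (stem l), M (b + size (stem l) + 1) = size (loop l) &
   forall x,
   (forall i, i < size (stem l) -> M (b + 1 + i) = enum_rank (nth x (stem l) i)) /\
   (forall i, i < size (loop l) -> M (b + size (stem l) + 2 + i) = enum_rank (nth x (loop l) i))].
Proof.
rewrite /encode_lasso /encode_word => /holds_at_cat[].
move=> /holds_at_cons[h1 h2]; rewrite /= size_map => /holds_at_cons[h3 h4].
split=> //; first by rewrite -h3; congr M; lia.
move=> x; split=> i Hi; first by rewrite h2 ?size_map // (nth_map x).
rewrite -(nth_map x 0 (fun a => nat_of_ord (enum_rank a))) // -h4 ?size_map //.
by congr M; lia.
Qed.

(* Address of the first letter of the loop of a lasso encoded at [b]. *)
Definition jump_start (b : nat) l : nat := b + size (stem l) + 2.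

(** The two updated addresses are those of the last letter of the stem (or of the stem's length
    field, if the stem is empty) and of the last letter of the loop. *)
Fixpoint jumps (b : nat) ls (f : nat -> nat) : nat -> nat :=
  if ls is l :: ls' then
    jumps (b + code_size l) ls'
      (update (update f (b + size (stem l)) (jump_start b l))
        (b + size (stem l) + 1 + size (loop l)) (jump_start b l))
  else f.

Lemma jumps_below b ls f k : k < b -> jumps b ls f k = f k.
Proof.
elim: ls b f => [|l ls IH] b f kb //=.
by rewrite IH ?updN //; lia.
Qed.

Lemma jumps_le b ls f E : (forall k, f k <= E) -> b + total_size ls <= E ->
  forall k, jumps b ls f k <= E.
Proof.
rewrite /total_size; elim: ls b f => [|l ls IH] b f fE //=.
rewrite big_cons => le; apply: IH; last lia.
have := loop_size l; move: le; rewrite /code_size /lasso_size => le l0 k.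
by rewrite /update /jump_start; do 2 (case: eqP => _; first lia).
Qed.

Definition lasso_jumps (J : nat -> nat) (b : nat) l : Prop :=
  forall k, b <= k < b + code_size l -> J k =
    if (k == b + size (stem l)) || (k == b + size (stem l) + 1 + size (loop l))
    then jump_start b l else 0.

Fixpoint lassos_at (M0 J : nat -> nat) (b : nat) ls : Prop :=
  if ls is l :: ls' then
    [/\ holds_at M0 b (encode_lasso l), lasso_jumps J b l &
        lassos_at M0 J (b + code_size l) ls']
  else True.

Lemma jumps_lassos_at M0 b ls f :
  (forall k, b <= k -> f k = 0) ->
  holds_at M0 b (encode_lassos ls) ->
  lassos_at M0 (jumps b ls f) b ls.
Proof.
elim: ls b f => [|l ls IH] b f f0 //; rewrite encode_lassos_cons => /holds_at_cat[h1 h2].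
rewrite size_encode_lasso in h2; split=> //; last first.
  apply: IH h2 => k Hk; have := loop_size l; move: Hk; rewrite /code_size /lasso_size => *.
  by rewrite /update !ifF ?f0 //; lia.
move=> k /andP[k1 k2]; rewrite /= jumps_below // /update.
by do 2 (case: eqP => _; rewrite ?orbT ?orbF //=); rewrite f0.
Qed.

(** The body is a parameter because the lassos are walked through for three purposes: to find where
    they end, to write the jump table and to test a vector. *)
Definition traverse (body : prog) : prog := (
  70 <~ #6;; 71 <~ @[#3] + @[#4];;
  While ($71) (
    body;; 72 <~ @[$70];; 70 <~ ($70 + $72) + #1;;
    70 <~ ($70 + @[$70]) + #1;; 71 <~ $71 - #1))%P.

Lemma run_traverse E M0 body B (I : nat -> seq (lasso S) -> state -> Prop) ls s :
  (forall b ls s s', I b ls s -> memory s' = memory s ->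
     (forall r, r \notin [:: 70; 71; 72] -> reg s' r = reg s r) -> I b ls s') ->
  (forall b ls s, I b ls s -> forall a, a < E -> memory s a = M0 a) ->
  (forall b l ls s, I b (l :: ls) s -> reg s 70 = b ->
     holds_at M0 b (encode_lasso l) -> b + code_size l <= E ->
     run body s B (fun s' => [/\ I (b + code_size l) ls s', reg s' 70 = b &
       reg s' 71 = reg s 71])) ->
  M0 3 + M0 4 = size ls -> holds_at M0 6 (encode_lassos ls) ->
  6 + total_size ls <= E -> I 6 ls s ->
  run (traverse body) s (size ls * (B + 40) + 40) (fun s' =>
    reg s' 70 = 6 + total_size ls /\ I (6 + total_size ls) [::] s').
Proof.
move=> Ireg Imem Ibody m34 h le I0; apply: run_le.
  do 2 (apply: run_seq; apply: run_setreg => /=); upd.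
  rewrite !(Imem _ _ _ I0); try lia.
  rewrite m34.
  apply: (run_while_seq (l := ls) (B := fun _ => B + 30) (I := fun ls' s' => exists b,
    [/\ I b ls' s', reg s' 70 = b, reg s' 71 = size ls', b + total_size ls' = 6 + total_size ls &
     holds_at M0 b (encode_lassos ls')])).
  - exists 6; split=> //; apply: Ireg I0 _ _ => //= r; rewrite !inE !negb_or => /and3P[/negbTE a1 /negbTE a2 _].
    by rewrite a1 a2.
  - move=> s1 [b [I1 e70 e71 tot _]]; split; first by rewrite /= e71.
    by move: tot; rewrite {1}/total_size big_nil addn0 => <-.
  move=> l ls' s1 [b [I1 e70 e71 tot hb]]; move: hb.
  rewrite encode_lassos_cons => /holds_at_cat[h1 h2].
  rewrite size_encode_lasso in h2.
  have tot' : b + code_size l + total_size ls' = 6 + total_size ls.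
    by rewrite -tot /total_size big_cons; lia.
  rewrite /= e71; split=> //; apply: run_le.
    apply: run_seq; apply: (run_imp (Ibody _ _ _ _ I1 e70 h1 _)); first lia.
    move=> s2 [I2 f70 f71].
    have [u v _] := encode_lasso_holds h1.
    have sz : code_size l = size (stem l) + size (loop l) + 2 by [].
    do 3 (apply: run_seq; apply: run_setreg => /=); apply: run_setreg; upd.
    have r70 : b + size (stem l) + 1 + size (loop l) + 1 = b + code_size l by lia.
    rewrite f70 !(Imem _ _ _ I2) ?u ?v ?r70; try lia.
    exists (b + code_size l); split=> //; last by rewrite f71 e71 subn1.
    apply: Ireg I2 _ _ => //= r; rewrite !inE !negb_or => /and3P[/negbTE n0 /negbTE n1 /negbTE n2].
    by rewrite n0 n1 n2.
  rewrite /=; lia.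
rewrite /= big_const_seq count_predT iter_addn_0; lia.
Qed.
End Lassos.

(** * Derivations and the memory layout *)

Section Derivations.
Variables (S Nt : finType) (G : grammar S Nt).

(** A big-step form of [rewrites]: subtrees are derived independently, which gives a structural
    induction without interleaved rewriting steps. *)
Inductive derives : ltl (S + Nt) -> ltl S -> Prop :=
  | derives_letter a : derives (Atom (inl a)) (Atom a)
  | derives_production X t phi : List.In (X, t) (productions G) ->
      derives t phi -> derives (Atom (inr X)) phi
  | derives_And t1 t2 p q : derives t1 p -> derives t2 q ->
      derives (And t1 t2) (And p q)
  | derives_Or t1 t2 p q : derives t1 p -> derives t2 q ->
      derives (Or t1 t2) (Or p q)
  | derives_Not t p : derives t p -> derives (Not t) (Not p)
  | derives_Next t p : derives t p -> derives (Next t) (Next p)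
  | derives_Until t1 t2 p q : derives t1 p -> derives t2 q ->
      derives (Until t1 t2) (Until p q).

Let rt := clos_refl_trans _ (rewrites G).

Lemma rt_map (f : ltl (S + Nt) -> ltl (S + Nt)) t t' :
  (forall u u', rewrites G u u' -> rewrites G (f u) (f u')) ->
  rt t t' -> rt (f t) (f t').
Proof.
move=> Hf; elim=> [u u' /Hf|u|u v w _ IH1 _ IH2].
- exact: rt_step.
- exact: rt_refl.
- exact: rt_trans IH1 IH2.
Qed.

Lemma rt_map2 (f : ltl (S + Nt) -> ltl (S + Nt) -> ltl (S + Nt)) t1 t1' t2 t2' :
  (forall u u' v, rewrites G u u' -> rewrites G (f u v) (f u' v)) ->
  (forall u v v', rewrites G v v' -> rewrites G (f u v) (f u v')) ->
  rt t1 t1' -> rt t2 t2' -> rt (f t1 t2) (f t1' t2').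
Proof.
move=> Hl Hr r1 r2; apply: (@rt_trans _ _ _ (f t1' t2)).
  by apply: (@rt_map (f^~ t2)) r1 => u u'; apply: Hl.
by apply: (@rt_map (f t1')) r2 => u u'; apply: Hr.
Qed.

Lemma derives_rt t phi : derives t phi -> rt t (ltl_map inl phi).
Proof.
elim=> {t phi} [a|X t phi Xt _ IH|t1 t2 p q _ IH1 _ IH2|t1 t2 p q _ IH1 _ IH2|
    t p _ IH|t p _ IH|t1 t2 p q _ IH1 _ IH2] /=.
- exact: rt_refl.
- by apply: rt_trans IH; apply: rt_step; constructor.
- by apply: rt_map2 IH1 IH2; [apply: rw_And_l | apply: rw_And_r].
- by apply: rt_map2 IH1 IH2; [apply: rw_Or_l | apply: rw_Or_r].
- by apply: rt_map IH; apply: rw_Not.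
- by apply: rt_map IH; apply: rw_Next.
- by apply: rt_map2 IH1 IH2; [apply: rw_Until_l | apply: rw_Until_r].
Qed.

Lemma derives_refl phi : derives (ltl_map inl phi) phi.
Proof. by elim: phi => /=; constructor. Qed.

(** A rewriting step can be absorbed at the front of a derivation. [langP] folds a whole rewriting
    sequence this way, starting from its end with [derives_refl]. *)
Lemma rewrites_derives t t' : rewrites G t t' ->
  forall phi, derives t' phi -> derives t phi.
Proof.
elim=> {t t'}.
- by move=> X t Xt phi; apply: derives_production.
all: by move=> * ; match goal with H : derives _ _ |- _ => inversion H; subst end;
  constructor; auto.
Qed.

Lemma langP phi : lang G phi <-> derives (Atom (inr (start G))) phi.
Proof.
split; last exact: derives_rt.
move/(@Operators_Properties.clos_rt_rt1n _ _ _ _); move Et: (ltl_map _ _) => t r.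
elim: r Et => [u <-|u v w uv _ IH Et]; first exact: derives_refl.
exact: rewrites_derives uv _ (IH Et).
Qed.
End Derivations.

Section Encoding.
Variables (S Nt : finType).

Lemma size_encode_tree (t : ltl (S + Nt)) : size (encode_tree t) = 2 * ltl_size t.
Proof.
elim: t => [[a|Y]|t1 IH1 t2 IH2|t1 IH1 t2 IH2|t IH|t IH|t1 IH1 t2 IH2] //=;
  rewrite !size_cat ?IH1 ?IH2 ?IH /=; lia.
Qed.

Lemma encode_production_size (r : Nt * ltl (S + Nt)) :
  size (encode_production r) = 2 + 2 * ltl_size r.2.
Proof. by rewrite /= size_encode_tree. Qed.

End Encoding.

(** * Slots, shared formulas and the worklist invariant *)

Section Saturation.
Variables (S Nt : finType) (G : grammar S Nt).
Variables (E base : nat) (M0 J : nat -> nat).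
Hypothesis J_le : forall k, k < E -> J k <= E.
Hypothesis E_base : E <= base.
Hypothesis base_gt0 : 0 < base.
Let X := 2 ^ E.
Let op_vec := op_vector E M0 J.

Lemma X_gt0 : 0 < X. Proof. by rewrite expn_gt0. Qed.

(* Above the input, memory consists of records of 16 cells, [X] for each site.
   Record [v] of site [i] is the slot of the vector [v]: cells 0-2 hold a formula
   node in the format of [stored], 3 a presence flag, 4 the link of the worklist
   and 5 the address of the site.  Cell 6 of record [k] of site 0 holds [J k].
   Record 0 of a site also holds the rule (operation, two sources, target) in
   which the site is used (8-11), the next site with the same nonterminal (12)
   and the link of the parsing stack (13). *)
Definition cell (i v : nat) : nat := base + 16 * (i * X + v).

(** [f], [v] and [i] are recovered from an address by division with remainder, first by 16 and then
    by [X]. *)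
Lemma cell_inj i v f i' v' f' : v < X -> v' < X -> f < 16 -> f' < 16 ->
  (cell i v + f == cell i' v' + f') = [&& i == i', v == v' & f == f'].
Proof.
move=> vX vX' fl fl'; apply/eqP/and3P; last by case=> /eqP-> /eqP-> /eqP->.
rewrite /cell => H.
have : (i * X + v) * 16 + f = (i' * X + v') * 16 + f' by lia.
move=> /[dup] /(congr1 (fun x => x %/ 16)) /[swap] /(congr1 (fun x => x %% 16)).
rewrite !modnMDl !modn_small // => ->; rewrite !divnMDl // !divn_small // !addn0.
move=> /[dup] /(congr1 (fun x => x %/ X)) /[swap] /(congr1 (fun x => x %% X)).
by rewrite !modnMDl !modn_small // => ->; rewrite !divnMDl ?X_gt0 // !divn_small // !addn0 => ->.
Qed.

Lemma upd_cell M i v f x i' v' f' : v < X -> v' < X -> f < 16 -> f' < 16 ->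
  update M (cell i v + f) x (cell i' v' + f') =
  if [&& i' == i, v' == v & f' == f] then x else M (cell i' v' + f').
Proof. by move=> *; rewrite /update cell_inj. Qed.

Lemma cell_base i v f : base <= cell i v + f.
Proof. rewrite /cell; lia. Qed.

Fixpoint vector_of (phi : ltl S) : nat :=
  match phi with
  | Atom a => op_vec 0 (enum_rank a) 0
  | And p q => op_vec 1 (vector_of p) (vector_of q)
  | Or p q => op_vec 2 (vector_of p) (vector_of q)
  | Not p => op_vec 3 (vector_of p) 0
  | Next p => op_vec 4 (vector_of p) 0
  | Until p q => op_vec 5 (vector_of p) (vector_of q)
  end.

Lemma vector_of_lt phi : vector_of phi < X.
Proof. by case: phi => *; apply: op_vector_lt. Qed.

(* [stored] restricted to slots that are present: unlike [stored] itself it is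
   stable when new slots are filled. *)
Fixpoint shared (M : nat -> nat) (D : seq (nat * nat)) (a : nat) (phi : ltl S) : Prop :=
  (exists2 x, x \in D & a = cell x.1 x.2) /\
  match phi with
  | Atom x => M a = 0 /\ M (a + 1) = enum_rank x
  | And p q => [/\ M a = 1, shared M D (M (a + 1)) p & shared M D (M (a + 2)) q]
  | Or p q => [/\ M a = 2, shared M D (M (a + 1)) p & shared M D (M (a + 2)) q]
  | Not p => M a = 3 /\ shared M D (M (a + 1)) p
  | Next p => M a = 4 /\ shared M D (M (a + 1)) p
  | Until p q => [/\ M a = 5, shared M D (M (a + 1)) p & shared M D (M (a + 2)) q]
  end.

(** The second half of [shared] with the cell contents as arguments, so that it can speak of a node
    held in registers before it is written. *)
Definition node_of (M : nat -> nat) (D : seq (nat * nat)) (tag c1 c2 : nat)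
    (phi : ltl S) : Prop :=
  match phi with
  | Atom x => tag = 0 /\ c1 = enum_rank x
  | And p q => [/\ tag = 1, shared M D c1 p & shared M D c2 q]
  | Or p q => [/\ tag = 2, shared M D c1 p & shared M D c2 q]
  | Not p => tag = 3 /\ shared M D c1 p
  | Next p => tag = 4 /\ shared M D c1 p
  | Until p q => [/\ tag = 5, shared M D c1 p & shared M D c2 q]
  end.

Lemma sharedE M D a phi : shared M D a phi <->
  (exists2 x, x \in D & a = cell x.1 x.2) /\
  node_of M D (M a) (M (a + 1)) (M (a + 2)) phi.
Proof. by case: phi. Qed.

Lemma shared_stored M D a phi : shared M D a phi -> stored M a phi.
Proof.
elim: phi a => [x|p IHp q IHq|p IHp q IHq|p IHp|p IHp|p IHp q IHq] a [_] /=;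
  rewrite addn1 ?addn2; by case; constructor; auto.
Qed.

Lemma shared_mono M M' D D' a phi :
  (forall x f, x \in D -> f < 3 -> M' (cell x.1 x.2 + f) = M (cell x.1 x.2 + f)) ->
  {subset D <= D'} -> shared M D a phi -> shared M' D' a phi.
Proof.
move=> HM HD.
have H0 x : x \in D -> M' (cell x.1 x.2) = M (cell x.1 x.2).
  by move=> xD; have := HM x 0 xD erefl; rewrite addn0.
have ex b : (exists2 x, x \in D & b = cell x.1 x.2) -> exists2 x, x \in D' & b = cell x.1 x.2.
  by move=> [x xD ->]; exists x => //; apply: HD.
by elim: phi a => [x|p IHp q IHq|p IHp q IHq|p IHp|p IHp|p IHp q IHq] a [[y yD ->]] /= [];
  (split; first by apply: ex; exists y); rewrite H0 // !HM //; split=> //; auto.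
Qed.

(* [label i] is the sentential form whose derived formulas site [i] collects,
   [up i] the rule (operation, sources, target) that uses site [i], and [nxt]
   chains a nonterminal with all its occurrences. *)
Record graph := Graph {
  nsites : nat;
  label : nat -> ltl (S + Nt);
  up : nat -> option (nat * nat * nat * nat);
  nxt : nat -> option nat }.

(** A 0 in cell 11 or 12 stands for no rule or no next site; this is unambiguous because [base] is
    positive and so is every site address. *)
Record header_ok (g : graph) (M : nat -> nat) : Prop := HeaderOk {
  h_input : forall a, a < base -> M a = M0 a;
  h_jump : forall k, k < E -> M (cell 0 k + 6) = J k;
  h_up : forall i,
    match up g i with
    | None => M (cell i 0 + 11) = 0
    | Some (op, i1, i2, it) =>
        [/\ M (cell i 0 + 8) = op, M (cell i 0 + 9) = cell i1 0,
            M (cell i 0 + 10) = cell i2 0 & M (cell i 0 + 11) = cell it 0]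
    end;
  h_nxt : forall i, M (cell i 0 + 12) = if nxt g i is Some j then cell j 0 else 0 }.

Definition same_header (M M' : nat -> nat) : Prop :=
  (forall a, a < base -> M' a = M a) /\
  (forall i v f, v < X -> 6 <= f < 16 -> M' (cell i v + f) = M (cell i v + f)).

Lemma E_lt_X : E < X. Proof. exact: ltn_expl. Qed.

Lemma header_lasso g M : header_ok g M -> lasso_memory E base M0 J M.
Proof.
move=> [h1 h2 _ _]; split=> k kE; first by apply: h1; lia.
by rewrite -h2 // /cell mul0n.
Qed.

Lemma same_header_trans M1 M2 M3 :
  same_header M1 M2 -> same_header M2 M3 -> same_header M1 M3.
Proof.
by move=> [a b] [c d]; split=> *; [rewrite c ?a | rewrite d ?b].
Qed.

Lemma header_same g M M' : same_header M M' -> header_ok g M -> header_ok g M'.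
Proof.
move=> [s1 s2] [h1 h2 h3 h4]; have X0 := X_gt0; have EX := E_lt_X.
split.
- by move=> a Ha; rewrite s1 ?h1.
- by move=> k Hk; rewrite s2 ?h2 //; apply: ltn_trans EX.
- by move=> i; have := h3 i; case: (up g i) => [[[[op i1] i2] it]|]; rewrite !s2.
- by move=> i; rewrite s2.
Qed.

(** [D] is a ghost list of the filled slots. [s_sound] is the soundness half of the algorithm. *)
Record slots_ok (g : graph) (D : seq (nat * nat)) (M : nat -> nat) : Prop := SlotsOk {
  s_uniq : uniq D;
  s_bound : forall x, x \in D -> x.1 < nsites g /\ x.2 < X;
  s_present : forall i v, v < X -> (M (cell i v + 3) != 0) = ((i, v) \in D);
  s_site : forall x, x \in D -> M (cell x.1 x.2 + 5) = cell x.1 0;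
  s_sound : forall x, x \in D -> exists phi,
    [/\ shared M D (cell x.1 x.2) phi, derives G (label g x.1) phi &
        vector_of phi = x.2] }.

Fixpoint linked (M : nat -> nat) (a : nat) (W : seq (nat * nat)) : Prop :=
  if W is x :: W' then a = cell x.1 x.2 /\ linked M (M (a + 4)) W' else a = 0.

Lemma eq_linked M M' a W :
  (forall x, x \in W -> M' (cell x.1 x.2 + 4) = M (cell x.1 x.2 + 4)) ->
  linked M a W -> linked M' a W.
Proof.
elim: W a => [|x W IH] a //= H [-> L]; split=> //.
rewrite H ?mem_head //; apply: IH => // y yW; apply: H.
by rewrite inE yW orbT.
Qed.

Record sat_inv (g : graph) (D W : seq (nat * nat)) (s : state) : Prop := SatInv {
  i_globals : globals E base s;
  i_header : header_ok g (memory s);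
  i_slots : slots_ok g D (memory s);
  i_linked : linked (memory s) (reg s 80) W;
  i_sub : {subset W <= D} }.

(** A filled slot is never overwritten: pointers to it keep denoting the same finite formula, and it
    enters the worklist only once. *)
Definition insert_prog : prog := (
  34 <~ $30 + times16 ($23);;
  If @[$34 + #3] Skip
    ($34 + #0 ::= $31;; $34 + #1 ::= $32;; $34 + #2 ::= $33;; $34 + #3 ::= #1;;
     $34 + #4 ::= $80;; $34 + #5 ::= $30;; 80 <~ $34))%P.

Lemma run_insert g D W s i w phi :
  sat_inv g D W s -> reg s 30 = cell i 0 -> reg s 23 = w -> i < nsites g -> w < X ->
  node_of (memory s) D (reg s 31) (reg s 32) (reg s 33) phi ->
  derives G (label g i) phi -> vector_of phi = w ->
  run insert_prog s 200 (fun s' => exists new,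
    [/\ sat_inv g (new ++ D) (new ++ W) s', (i, w) \in new ++ D,
        same_header (memory s) (memory s') &
        forall r, r != 34 -> r != 80 -> reg s' r = reg s r]).
Proof.
move=> [gl hd sl li sub] e30 e23 isite wX nd der vec.
have ad : eval s ($30 + times16 ($23))%P = cell i w by rewrite /= e30 e23 /cell; lia.
have X0 := X_gt0.
apply: run_le.
  apply: run_seq; apply: run_setreg; rewrite ad.
  have pr := s_present sl i wX.
  apply: run_if; rewrite /= updE => H.
    apply: run_skip; exists [::]; split=> [||//|r r34 _]; last by rewrite /= updN.
      by split=> //; case: gl => *; split; rewrite /= updN.
    by rewrite -pr.
  have xD : (i, w) \notin D by rewrite -pr H.
  do 6 (apply: run_seq; apply: run_setmem); apply: run_setreg.
  rewrite /= !(updE, updN) // !addn0.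
  set M' := update _ (cell i w + 5) _.
  have M'E i' v' f : v' < X -> f < 16 -> (i', v') != (i, w) -> M' (cell i' v' + f) = memory s (cell i' v' + f).
    move=> vX f16; rewrite xpair_eqE negb_and => ne.
    rewrite /M' !upd_cell // -[cell i w]addn0 !upd_cell //.
    by rewrite !andbA; case: (i' == i) ne => //= /negbTE ->.
  have M'x f : f < 16 -> M' (cell i w + f) =
    match f with 0 => reg s 31 | 1 => reg s 32 | 2 => reg s 33 | 3 => 1 | 4 => reg s 80
    | 5 => reg s 30 | _ => memory s (cell i w + f) end.
    move=> f16; rewrite /M' !upd_cell // -[X in update _ X]addn0 !upd_cell // !eqxx /=.
    by move: f f16; do 6 (case=> [|] //).
  have M'D x f : x \in D -> f < 16 -> M' (cell x.1 x.2 + f) = memory s (cell x.1 x.2 + f).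
    move=> xinD f16; have [_ vX] := s_bound sl xinD.
    by apply: M'E => //; case: x xinD vX => a b xinD _; apply: contraNneq xD => <-.
  have sh : same_header (memory s) M'.
    split=> [a Ha|i' v' f vX /andP[f6 f16]].
      by rewrite /M' !updN //; have := cell_base i w; rewrite /cell; lia.
    case: (altP ((i', v') =P (i, w))) => [[-> ->]|ne]; last exact: M'E.
    by rewrite M'x //; do 6 (case: f f6 f16 => [|f] // f6 f16).
  exists [:: (i, w)]; split=> //.
  - split=> /=.
    + by case: gl => *; split; rewrite /= !updN.
    + exact: header_same hd.
    + split.
      * by rewrite cons_uniq xD (s_uniq sl).
      * by move=> x; rewrite inE => /predU1P[->|/(s_bound sl)].
      * move=> i' v' vX; rewrite inE.
        case: (altP ((i', v') =P (i, w))) => [[-> ->]|ne]; first by rewrite M'x.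
        by rewrite M'E // (s_present sl).
      * move=> x; rewrite inE => /predU1P[->|xinD]; first by rewrite M'x.
        by rewrite M'D // (s_site sl).
      * have mono a psi : shared (memory s) D a psi -> shared M' ((i, w) :: D) a psi.
          apply: shared_mono => [x f xinD f3|x xinD]; first by rewrite M'D //; lia.
          by rewrite inE xinD orbT.
        move=> x; rewrite inE => /predU1P[->|xinD].
          exists phi; split=> //; apply/sharedE; split; first by exists (i, w); rewrite ?mem_head.
          rewrite -[X in M' X]addn0 !M'x //.
          by case: phi nd {der vec} => [y|p q|p q|p|p|p q] /= [*]; split=> //; apply: mono.
        by have [psi [? ? ?]] := s_sound sl xinD; exists psi; split=> //; apply: mono.
    + rewrite updE; split=> //; rewrite M'x //.
      by apply: eq_linked li => x xW; apply: M'D => //; apply: sub.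
    + by move=> x; rewrite !inE => /predU1P[->|/sub ->]; rewrite ?eqxx ?orbT.
  - by rewrite mem_head.
  - by move=> r r34 r80; rewrite !updN.
by [].
Qed.

(** * Saturation *)

Definition mk_op (A : Type) (op : nat) (p q : ltl A) : ltl A :=
  match op with
  | 1 => And p q | 2 => Or p q | 3 => Not p | 4 => Next p | _ => Until p q
  end.

(** Operation 6 serves two purposes, from the root of a right-hand side to its nonterminal and from
    a site of a nonterminal to the next one. Both are sound because the target derives whatever the
    source derives. *)
Definition rule_ok (g : graph) (op i1 i2 it : nat) : Prop :=
  [/\ i1 < nsites g, i2 < nsites g, it < nsites g &
      (0 < op < 6 /\ label g it = mk_op op (label g i1) (label g i2)) \/
      (op = 6 /\ forall phi, derives G (label g i1) phi -> derives G (label g it) phi)].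

Lemma mk_op_node M D op c1 c2 p q : 0 < op < 6 -> shared M D c1 p ->
  shared M D c2 q -> node_of M D op c1 c2 (mk_op op p q).
Proof. by case: op => [|[|[|[|[|[|op]]]]]]. Qed.

Lemma mk_op_derives op t1 t2 p q : 0 < op < 6 -> derives G t1 p ->
  derives G t2 q -> derives G (mk_op op t1 t2) (mk_op op p q).
Proof. by case: op => [|[|[|[|[|[|op]]]]]] //= *; constructor. Qed.

Lemma mk_op_vector op p q : 0 < op < 6 ->
  vector_of (mk_op op p q) = op_vec op (vector_of p) (vector_of q).
Proof. by case: op => [|[|[|[|[|[|op]]]]]]. Qed.

(** For a copy, cells 0 to 2 of the source node are duplicated, since [stored] has no indirection
    nodes; for the other operations the new node points to the two source slots. *)
Definition pair_prog : prog := (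
  If @[$50 + #3]
    (If @[$51 + #3]
      (20 <~ $35;; 21 <~ $38;; 22 <~ $39;; vector_prog;;
       If ($35 - #5)
         (31 <~ @[$50];; 32 <~ @[$50 + #1];; 33 <~ @[$50 + #2])
         (31 <~ $35;; 32 <~ $50;; 33 <~ $51);;
       insert_prog)
      Skip)
    Skip)%P.

Lemma globals_vectors s : globals E base s -> reg s 91 = X. Proof. by case. Qed.

Lemma sat_inv_regs g D W s s' : sat_inv g D W s -> memory s' = memory s ->
  (forall r, 80 <= r -> reg s' r = reg s r) -> sat_inv g D W s'.
Proof.
move=> [[g0 g1 g2] hd sl li sub] m fr; split; rewrite ?m // ?fr //.
by split; rewrite fr.
Qed.

Lemma run_pair g D W s op i1 i2 it v1 v2 :
  sat_inv g D W s -> rule_ok g op i1 i2 it -> v1 < X -> v2 < X ->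
  reg s 35 = op -> reg s 38 = v1 -> reg s 39 = v2 -> reg s 50 = cell i1 v1 ->
  reg s 51 = cell i2 v2 -> reg s 30 = cell it 0 ->
  run pair_prog s (1400 * X ^ 3) (fun s' => exists new,
    [/\ sat_inv g (new ++ D) (new ++ W) s',
        (i1, v1) \in D -> (i2, v2) \in D -> (it, op_vec op v1 v2) \in new ++ D,
        same_header (memory s) (memory s') &
        forall r, 25 <= r -> r \notin [:: 31; 32; 33; 34; 80] -> reg s' r = reg s r]).
Proof.
move=> inv [L1 L2 Lt ro] v1X v2X e35 e38 e39 e50 e51 e30; have X0 := X_gt0.
have [gl hd sl li sub] := inv; have lm := header_lasso hd.
have same0 : same_header (memory s) (memory s) by [].
have skip : (i1, v1) \notin D \/ (i2, v2) \notin D ->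
  run Skip s 1 (fun s' => exists new,
    [/\ sat_inv g (new ++ D) (new ++ W) s',
        (i1, v1) \in D -> (i2, v2) \in D -> (it, op_vec op v1 v2) \in new ++ D,
        same_header (memory s) (memory s') &
        forall r, 25 <= r -> r \notin [:: 31; 32; 33; 34; 80] -> reg s' r = reg s r]).
  move=> no; apply: run_skip; exists [::]; split=> //.
  by case: no => /negbTE ->.
apply: run_le.
  apply: run_if => /= H; last by apply: skip; left; rewrite -(s_present sl) // -e50 H.
  rewrite e50 (s_present sl) // in H.
  apply: run_if => /= H2; last by apply: skip; right; rewrite -(s_present sl) // -e51 H2.
  rewrite e51 (s_present sl) // in H2.
  have [phi1 [sh1 der1 vec1]] := s_sound sl H.
  have [phi2 [sh2 der2 vec2]] := s_sound sl H2.
  rewrite /= in sh1 der1 vec1 sh2 der2 vec2.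
  do 3 (apply: run_seq; apply: run_setreg => /=).
  apply: run_seq; apply: (run_imp (run_vector (base := base) (M0 := M0) J_le _ _ _)); upd; rewrite ?e35 ?e38 ?e39 //.
  move=> s1 [e23 m1 fr1 _].
  have r1 r : 25 <= r -> reg s1 r = reg s r by move=> Hr; regs_at r.
  apply: run_seq; apply: (run_imp (P := fun s' => exists phi,
    [/\ memory s' = memory s,
     forall r, 23 <= r -> r \notin [:: 31; 32; 33] -> reg s' r = reg s1 r,
     node_of (memory s) D (reg s' 31) (reg s' 32) (reg s' 33) phi,
     derives G (label g it) phi & vector_of phi = op_vec op v1 v2])).
    have fr2 a b c : forall r, 23 <= r -> r \notin [:: 31; 32; 33] ->
        (if r == 33 then a else if r == 32 then b else if r == 31 then c else reg s1 r) = reg s1 r.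
      by move=> r _; rewrite !inE !negb_or => /and3P[/negbTE -> /negbTE -> /negbTE ->].
    apply: run_if => /= Hop; rewrite r1 // e35 in Hop.
      case: ro => [[]|[op6 dd]]; first lia.
      do 2 (apply: run_seq; apply: run_setreg => /=); apply: run_setreg; upd.
      exists phi1; rewrite op6 /op_vec op_vector_copy // m1 !r1 // e50; split=> //.
      - exact: fr2.
      - by have [] := (sharedE _ _ _ _).1 sh1.
      - exact: dd.
    case: ro => [[op5 lab]|[]]; last lia.
    do 2 (apply: run_seq; apply: run_setreg => /=); apply: run_setreg; upd.
    exists (mk_op op phi1 phi2); rewrite m1 !r1 // e50 e51 e35; split=> //.
    - exact: fr2.
    - exact: mk_op_node.
    - by rewrite lab; apply: mk_op_derives.
    - by rewrite mk_op_vector // vec1 vec2.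
  move=> s2 [phi [m2 fr2 nd der vec]].
  have inv2 : sat_inv g D W s2.
    apply: sat_inv_regs inv m2 _ => r Hr; rewrite fr2 ?r1 //; try lia.
    by rewrite !inE; lia.
  apply: (run_imp (run_insert (w := op_vec op v1 v2) inv2 _ _ Lt _ _ der vec)).
  - by rewrite fr2 ?r1.
  - by rewrite fr2 // e23.
  - exact: op_vector_lt.
  - by rewrite m2.
  move=> s3 [new [inv3 mem3 sh3 fr3]]; exists new; split=> //.
    by rewrite -m2.
  move=> r Hr; rewrite !inE !negb_or => /and5P[n1 n2 n3 n4 n5].
  by rewrite fr3 // fr2 ?r1 //; [lia | rewrite !inE !negb_or n1 n2].
rewrite /= -/X 2!expnS expn1; nia.
Qed.

(** All pairs of vectors are tried, not only those with the slot being processed. For unary rules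
    and copies the two sources coincide and most pairs are redundant, which costs only a factor
    [X]. *)
Definition apply_prog : prog := (
  38 <~ #0;; 50 <~ $36;;
  While ($91 - $38) (
    39 <~ #0;; 51 <~ $37;;
    While ($91 - $39) (pair_prog;; 39 <~ $39 + #1;; 51 <~ $51 + #16);;
    38 <~ $38 + #1;; 50 <~ $50 + #16))%P.

Lemma run_apply g D W s op i1 i2 it :
  sat_inv g D W s -> rule_ok g op i1 i2 it ->
  reg s 35 = op -> reg s 36 = cell i1 0 -> reg s 37 = cell i2 0 -> reg s 30 = cell it 0 ->
  run apply_prog s (2000 * X ^ 5) (fun s' => exists new,
    [/\ sat_inv g (new ++ D) (new ++ W) s',
        forall v1 v2, (i1, v1) \in D -> (i2, v2) \in D -> (it, op_vec op v1 v2) \in new ++ D,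
        same_header (memory s) (memory s') &
        forall r, 52 <= r -> r != 80 -> reg s' r = reg s r]).
Proof.
move=> inv ro e35 e36 e37 e30; have X0 := X_gt0.
have cellS i v : cell i v + 16 = cell i (v + 1) by rewrite /cell; lia.
have bd := s_bound (i_slots inv).
pose same s' := [/\ reg s' 35 = op, reg s' 36 = cell i1 0, reg s' 37 = cell i2 0,
   reg s' 30 = cell it 0 & forall r, 52 <= r -> r != 80 -> reg s' r = reg s r].
apply: run_le.
  do 2 (apply: run_seq; apply: run_setreg => /=).
  (* Conclusions are guaranteed only for pairs already in [D] at the start. Slots added meanwhile
     are on the worklist and will trigger their rules again. *)
  apply: (run_while (n := X) (I := fun j s' => exists new v1,
    [/\ j = X - v1, reg s' 38 = v1, reg s' 50 = cell i1 v1, same s' &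
     [/\ sat_inv g (new ++ D) (new ++ W) s', same_header (memory s) (memory s') &
     forall w1 w2, w1 < v1 -> (i1, w1) \in D -> (i2, w2) \in D -> (it, op_vec op w1 w2) \in new ++ D]])).
  - exists [::], 0; upd; rewrite subn0 e36; split=> //; last split=> //.
      by split=> //= r *; rewrite !ifF //; lia.
    by apply: sat_inv_regs inv _ _ => //= r *; rewrite !ifF //; lia.
  - move=> j s1 [new [v1 [jE e38 e50 [_ _ _ _ sm] [inv1 sh H]]]] /=.
    rewrite e38 (globals_vectors (i_globals inv1)) => H0; exists new; split=> // w1 w2 in1.
    by have [_ /= w1X] := bd _ in1; apply: H => //; lia.
  move=> j s1 [new [v1 [jE e38 e50 [f35 f36 f37 f30 sm] [inv1 sh H]]]] /=.
  rewrite e38 (globals_vectors (i_globals inv1)) => H0; split; first lia.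
  have v1X : v1 < X by lia.
  do 2 (apply: run_seq; apply: run_setreg => /=).
  apply: run_seq; apply: (run_imp (P := fun s' => exists new',
    [/\ reg s' 38 = v1, reg s' 50 = cell i1 v1, same s' &
     [/\ sat_inv g (new' ++ D) (new' ++ W) s', same_header (memory s) (memory s'),
      forall w1 w2, w1 < v1 -> (i1, w1) \in D -> (i2, w2) \in D -> (it, op_vec op w1 w2) \in new' ++ D &
      forall w2, (i1, v1) \in D -> (i2, w2) \in D -> (it, op_vec op v1 w2) \in new' ++ D]])).
    apply: (run_while (n := X) (I := fun j s' => exists new' v2,
     [/\ j = X - v2, reg s' 39 = v2, reg s' 51 = cell i2 v2, same s' &
     [/\ reg s' 38 = v1, reg s' 50 = cell i1 v1,
      sat_inv g (new' ++ D) (new' ++ W) s', same_header (memory s) (memory s') & 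
      (forall w1 w2, w1 < v1 -> (i1, w1) \in D -> (i2, w2) \in D -> (it, op_vec op w1 w2) \in new' ++ D) /\
      forall w2, w2 < v2 -> (i1, v1) \in D -> (i2, w2) \in D -> (it, op_vec op v1 w2) \in new' ++ D]])).
    - exists new, 0; upd; rewrite subn0 f37; split=> //; last split=> //.
        by split=> //= r *; rewrite !ifF ?sm //; lia.
      by apply: sat_inv_regs inv1 _ _ => //= r *; rewrite !ifF //; lia.
    - move=> j' s2 [new' [v2 [_ e39 _ same2 [h38 h50 inv2 sh2 [H1 H2]]]]] /=.
      rewrite e39 (globals_vectors (i_globals inv2)) => H3; exists new'; split=> //; split=> // w2 in1 in2.
      by have [_ /= w2X] := bd _ in2; apply: H2 => //; lia.
    move=> j' s2 [new' [v2 [jE' e39 e51 [a35 a36 a37 a30 sm2] [h38 h50 inv2 sh2 [H1 H2]]]]] /=.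
    rewrite e39 (globals_vectors (i_globals inv2)) => H3; split; first lia.
    have v2X : v2 < X by lia.
    apply: run_seq; apply: (run_imp (run_pair inv2 ro v1X v2X a35 h38 e39 h50 e51 a30)).
    move=> s3 [new3 [inv3 in3 sh3 fr3]].
    apply: run_seq; apply: run_setreg; apply: run_setreg; upd.
    exists (new3 ++ new'), (v2 + 1); rewrite !fr3 //= e39 e51 cellS; split=> //.
    - lia.
    - split=> /=; rewrite ?fr3 // => r r52 r80.
      rewrite !ifF ?fr3 ?sm2 //; try lia.
      by rewrite !inE; lia.
    split=> //.
    - rewrite -!catA; apply: sat_inv_regs inv3 _ _ => //= r Hr.
      by rewrite !ifF //; lia.
    - exact: same_header_trans sh3.
    split.
    - by move=> w1 w2 lt in1 in2; rewrite -catA mem_cat H1 ?orbT.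
    move=> w2 lt in1 in2; have [lt'|e] : w2 < v2 \/ w2 = v2 by lia.
      by rewrite -catA mem_cat H2 ?orbT.
    by rewrite -catA e; apply: in3; rewrite mem_cat ?in1 -?e ?in2 orbT.
  move=> s2 [new' [g38 g50 [a35 a36 a37 a30 sm2] [inv2 sh2 H1 H2]]].
  apply: run_seq; apply: run_setreg; apply: run_setreg; upd.
  exists new', (v1 + 1); rewrite g38 g50 cellS; split=> //.
  - lia.
  - by split=> //= r r52 r80; rewrite !ifF ?sm2 //; lia.
  split=> //.
  - by apply: sat_inv_regs inv2 _ _ => //= r Hr; rewrite !ifF //; lia.
  move=> w1 w2 lt in1 in2; have [lt'|e] : w1 < v1 \/ w1 = v1 by lia.
    exact: H1.
  by rewrite e; apply: H2; rewrite // -e.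
rewrite /= -/X !(expnS X 4, expnS X 3); have : 0 < X ^ 3 by rewrite expn_gt0 X0.
move: (X ^ 3) => y y0; nia.
Qed.

Definition graph_ok (g : graph) : Prop :=
  (forall i op i1 i2 it, up g i = Some (op, i1, i2, it) -> rule_ok g op i1 i2 it) /\
  (forall i j, nxt g i = Some j -> rule_ok g 6 i i j).

(* When a slot is processed, the rule of its site is applied to all pairs of
   present slots, so conclusions of pairs of processed slots are present. *)
Definition closed_in (g : graph) (Q D : seq (nat * nat)) : Prop :=
  (forall op i1 i2 it v1 v2, up g i1 = Some (op, i1, i2, it) ->
     up g i2 = Some (op, i1, i2, it) -> (i1, v1) \in Q -> (i2, v2) \in Q ->
     (it, op_vec op v1 v2) \in D) /\
  (forall i j v, nxt g i = Some j -> (i, v) \in Q -> (j, v) \in D).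

(** Bounds the rounds of the saturation loop, since each slot is taken from the worklist at most
    once. *)
Lemma slots_size g D M : slots_ok g D M -> size D <= nsites g * X.
Proof.
move=> sl; have -> : nsites g * X = size [seq (i, v) | i <- iota 0 (nsites g), v <- iota 0 X].
  by rewrite size_allpairs !size_iota.
apply: uniq_leq_size (s_uniq sl) _ => -[i v] /(s_bound sl) [/= iN vX].
by apply/allpairsP; exists (i, v); rewrite !mem_iota.
Qed.

Definition saturate_prog : prog := (
  While ($80) (
    52 <~ $80;; 80 <~ @[$52 + #4];; 53 <~ @[$52 + #5];;
    30 <~ @[$53 + #11];;
    If ($30)
      (35 <~ @[$53 + #8];; 36 <~ @[$53 + #9];; 37 <~ @[$53 + #10];; apply_prog)
      Skip;;
    30 <~ @[$53 + #12];;
    If ($30) (35 <~ #6;; 36 <~ $53;; 37 <~ $53;; apply_prog) Skip))%P.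

Lemma cell_gt0 i v : cell i v != 0.
Proof. by rewrite /cell; lia. Qed.

Lemma run_saturate g D0 W0 s :
  sat_inv g D0 W0 s -> perm_eq D0 W0 -> graph_ok g ->
  run saturate_prog s (5000 * X ^ 6 * nsites g + 5) (fun s' => exists D,
    [/\ sat_inv g D [::] s', closed_in g D D, {subset D0 <= D} &
        forall r, 54 <= r -> r != 80 -> reg s' r = reg s r]).
Proof.
move=> inv0 perm0 [up_ok nxt_ok]; have X0 := X_gt0.
apply: run_le.
  (* [Q] collects the processed slots. As [D] is duplicate-free and a permutation of [Q ++ W], the
     size of [Q] yields the variant, and an empty [W] turns closure relative to [Q] into closure of
     [D]. *)
  apply: (run_while (n := nsites g * X) (I := fun j s' => exists Q D W,
    [/\ sat_inv g D W s', perm_eq D (Q ++ W), closed_in g Q D, {subset D0 <= D} &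
     j = nsites g * X - size Q /\ forall r, 54 <= r -> r != 80 -> reg s' r = reg s r])).
  - by exists [::], D0, W0; rewrite subn0; do !split=> //.
  - move=> j s1 [Q [D [W [inv perm cl sub [_ fr]]]]] /= e80; exists D.
    have W0' : W = [::].
      have := i_linked inv; rewrite e80; case: (W) => [|x W'] //= [H _].
      by have := cell_gt0 x.1 x.2; rewrite -H.
    have HQ : D =i Q by move=> x; rewrite (perm_mem perm) W0' cats0.
    split=> //; first by rewrite -W0'.
    case: cl => c1 c2; split=> [op i1 i2 it v1 v2 u1 u2 in1 in2|i i' v n in1].
      by apply: (c1 op i1 i2); rewrite -?HQ.
    by apply: c2 n _; rewrite -HQ.
  move=> j s1 [Q [D [W [inv perm cl sub [jE fr]]]]] /= e80.
  case: W inv perm => [|x W] inv perm; first by case/eqP: e80; have := i_linked inv.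
  have [gl hd sl /= [e80' li] subW] := inv.
  have xD : x \in D by apply: subW; rewrite mem_head.
  have [xN xX] := s_bound sl xD.
  have szQ : size Q < nsites g * X.
    by apply: leq_trans (slots_size sl); rewrite (perm_size perm) size_cat /= -addSnnS leq_addr.
  split; first lia.
  do 4 (apply: run_seq; apply: run_setreg => /=); upd; rewrite e80' (s_site sl xD).
  set s2 := State _ _.
  have inv2 : sat_inv g D W s2.
    split=> //; first by rewrite e80' in li; exact: li.
    by move=> y yW; apply: subW; rewrite inE yW orbT.
  have perm2 : perm_eq D ((x :: Q) ++ W).
    by rewrite (permPl perm) -cat1s perm_catCA.
  apply: run_seq; apply: (run_imp (P := fun s' => exists new,
    [/\ sat_inv g (new ++ D) (new ++ W) s', reg s' 53 = cell x.1 0,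
        forall r, 54 <= r -> r != 80 -> reg s' r = reg s r &
        forall op i1 i2 it v1 v2, up g x.1 = Some (op, i1, i2, it) ->
        (i1, v1) \in D -> (i2, v2) \in D -> (it, op_vec op v1 v2) \in new ++ D])).
    have Hup := h_up hd x.1.
    apply: run_if => /= H.
      case Eup: (up g x.1) Hup => [[[[op i1] i2] it]|] Hup; last by rewrite Hup in H.
      have [u8 u9 u10 u11] := Hup.
      do 3 (apply: run_seq; apply: run_setreg => /=); upd.
      apply: (run_imp (run_apply (g := g) (D := D) (W := W) _ (up_ok _ _ _ _ _ Eup) _ _ _ _)) => //.
        by apply: sat_inv_regs inv2 _ _ => //= r Hr; do 3 (rewrite ifF; last lia).
      move=> s3 [new [inv3 in3 sh3 fr3]]; exists new; split=> //.
      - by rewrite fr3.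
      - move=> r Hr r80; rewrite fr3 //=; last lia.
        by rewrite !ifF ?fr //; lia.
      - by move=> op' i1' i2' it' v1 v2 [<- <- <- <-]; apply: in3.
    apply: run_skip; exists [::]; split=> //.
    - by move=> r Hr r80; rewrite /= !ifF ?fr //; lia.
    case Eup: (up g x.1) Hup => [[[[op i1] i2] it]|] // [_ _ _ Hup].
    by rewrite Hup in H; have := cell_gt0 it 0; rewrite H.
  move=> s3 [new [inv3 e53 fr3 H3]].
  apply: run_seq; apply: run_setreg => /=; upd; rewrite e53.
  set s4 := State _ _.
  have inv4 : sat_inv g (new ++ D) (new ++ W) s4.
    by apply: sat_inv_regs inv3 _ _ => //= r Hr; rewrite !ifF //; lia.
  apply: (run_imp (P := fun s' => exists new,
    [/\ sat_inv g (new ++ D) (new ++ W) s',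
        forall r, 54 <= r -> r != 80 -> reg s' r = reg s r,
        forall op i1 i2 it v1 v2, up g x.1 = Some (op, i1, i2, it) ->
        (i1, v1) \in D -> (i2, v2) \in D -> (it, op_vec op v1 v2) \in new ++ D &
        forall i, nxt g x.1 = Some i -> (i, x.2) \in new ++ D])).
    have Hn := h_nxt (i_header inv3) x.1.
    apply: run_if => /= H.
      case En: (nxt g x.1) Hn => [i|] Hn; last by rewrite Hn in H.
      do 3 (apply: run_seq; apply: run_setreg => /=); upd.
      apply: (run_imp (run_apply (g := g) (D := new ++ D) (W := new ++ W) _ (nxt_ok _ _ En) _ _ _ _)) => //.
        by apply: sat_inv_regs inv4 _ _ => //= r Hr; rewrite !ifF //; lia.
      move=> s5 [new' [inv5 in5 sh5 fr5]]; exists (new' ++ new); split.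
      - by rewrite -!catA.
      - move=> r Hr r80; rewrite fr5 //=; last lia.
        by rewrite !ifF ?fr3 //; lia.
      - by move=> *; rewrite -catA mem_cat; apply/orP; right; eapply H3; eassumption.
      - move=> _ [<-]; have /in5 in5' : (x.1, x.2) \in new ++ D by rewrite mem_cat -surjective_pairing xD orbT.
        by rewrite -catA -{1}(op_vector_copy M0 J x.2 xX); apply: in5'; rewrite mem_cat -surjective_pairing xD orbT.
    apply: run_skip; exists new; split=> //.
    - by move=> r Hr r80; rewrite /= !ifF ?fr3 //; lia.
    move=> i En; rewrite En in Hn.
    by rewrite Hn in H; have := cell_gt0 i 0; rewrite H.
  move=> s5 [new5 [inv5 fr5 H5 H4]].
  exists (x :: Q), (new5 ++ D), (new5 ++ W); split=> //.
  - rewrite perm_sym perm_catCA perm_cat2l perm_sym; exact: perm2.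
  - have QD y : y \in x :: Q -> y \in D by move=> yQ; rewrite (perm_mem perm2) mem_cat yQ.
    case: cl => c1 c2; split.
    (* Both sources of a rule carry that same rule, so whichever of them is processed last triggers
       it. A pair in [x :: Q] either contains [x], whose rule has just been tried on all of [D], or
       was covered before. *)
    + move=> op i1 i2 it v1 v2 u1 u2 in1 in2.
      have [in1' in2'] := (QD _ in1, QD _ in2).
      move: in1 in2; rewrite !inE => /predU1P[e1 _|in1 /predU1P[e2|in2]].
      * by apply: (H5 _ i1 i2) => //; rewrite -e1.
      * by apply: (H5 _ i1 i2) => //; rewrite -e2.
      by rewrite mem_cat (c1 op i1 i2 it v1 v2) ?orbT.
    + move=> i i' v n; rewrite inE => /predU1P[e|inQ].
        by have := H4 i'; rewrite -e; apply.
      by rewrite mem_cat (c2 i i' v) ?orbT.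
  - by move=> y /sub yD; rewrite mem_cat yD orbT.
  - by rewrite jE /=; split=> //; lia.
rewrite /= -/X (expnS X 5); have : 0 < X ^ 5 by rewrite expn_gt0 X0.
move: (X ^ 5) (nsites g) => y n y0; nia.
Qed.

(** * Building the sites *)

Definition set_at (A : Type) (f : nat -> A) (i : nat) (x : A) : nat -> A :=
  fun j => if j == i then x else f j.

Definition add_site (g : graph) (t : ltl (S + Nt)) : graph :=
  Graph (nsites g).+1 (set_at (label g) (nsites g) t) (up g) (nxt g).
Definition set_up (g : graph) (i op i1 i2 it : nat) : graph :=
  Graph (nsites g) (label g) (set_at (up g) i (Some (op, i1, i2, it))) (nxt g).
Definition set_nxt (g : graph) (i : nat) (o : option nat) : graph :=
  Graph (nsites g) (label g) (up g) (set_at (nxt g) i o).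

Definition extends (g g' : graph) : Prop :=
  nsites g <= nsites g' /\ forall i, i < nsites g -> label g' i = label g i.

Lemma extends_trans g1 g2 g3 : extends g1 g2 -> extends g2 g3 -> extends g1 g3.
Proof.
move=> [a b] [c d]; split; first exact: leq_trans a c.
by move=> i Hi; rewrite d ?b //; apply: leq_trans a.
Qed.

Lemma slots_extends g g' D M : extends g g' -> slots_ok g D M -> slots_ok g' D M.
Proof.
move=> [n l] [u b p si so]; split=> // x xD; have [xn xX] := b _ xD.
  by split=> //; apply: leq_trans n.
by rewrite l //; apply: so.
Qed.

Lemma slots_write g D M i f x : 6 <= f < 16 -> slots_ok g D M ->
  slots_ok g D (update M (cell i 0 + f) x).
Proof.
move=> /andP[f6 f16] [u b p si so]; have X0 := X_gt0.
have same i' v f' : v < X -> f' < 6 ->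
  update M (cell i 0 + f) x (cell i' v + f') = M (cell i' v + f').
  by move=> vX f'6; rewrite upd_cell //; [rewrite (_ : (f' == f) = false) ?andbF //; lia|lia].
split=> //.
- by move=> i' v vX; rewrite same // p.
- by move=> y yD; rewrite same ?si //; case: (b _ yD).
move=> y yD; have [phi [sh d v]] := so _ yD; exists phi; split=> //.
by apply: shared_mono sh => // z f' zD f'3; rewrite same //; [case: (b _ zD) | lia].
Qed.

Lemma linked_write M i f x a W : f < 16 -> f != 4 -> (forall y, y \in W -> y.2 < X) ->
  linked M a W -> linked (update M (cell i 0 + f) x) a W.
Proof.
move=> f16 f4 WX; apply: eq_linked => y yW; have X0 := X_gt0.
by rewrite upd_cell ?WX // [4 == f]eq_sym (negbTE f4) !andbF.
Qed.

Lemma sat_inv_write g g' D W s i f x : 6 <= f < 16 -> sat_inv g D W s ->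
  extends g g' -> header_ok g' (update (memory s) (cell i 0 + f) x) ->
  sat_inv g' D W (State (reg s) (update (memory s) (cell i 0 + f) x)).
Proof.
move=> Hf [gl hd sl li sub] ext hd'; split=> //=.
  by apply: slots_extends ext _; apply: slots_write.
apply: linked_write => //; try lia.
by move=> y /sub yD; have [] := s_bound sl yD.
Qed.

Lemma header_write13 g M i x : header_ok g M ->
  header_ok g (update M (cell i 0 + 13) x).
Proof.
move=> [h1 h2 h3 h4]; have X0 := X_gt0; have EX := E_lt_X; split.
- by move=> a Ha; rewrite updN ?h1 //; have := cell_base i 0 13; lia.
- by move=> k kE; rewrite upd_cell ?h2 ?andbF //; lia.
- move=> j; have := h3 j; case: (up g j) => [[[[op i1] i2] it]|];
  by rewrite !upd_cell // !andbF.
by move=> j; rewrite upd_cell // !andbF.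
Qed.

Lemma header_write12 g M i o : header_ok g M ->
  header_ok (set_nxt g i o) (update M (cell i 0 + 12) (if o is Some j then cell j 0 else 0)).
Proof.
move=> [h1 h2 h3 h4]; have X0 := X_gt0; have EX := E_lt_X; split.
- by move=> a Ha; rewrite updN ?h1 //; have := cell_base i 0 12; lia.
- by move=> k kE; rewrite upd_cell ?h2 ?andbF //; lia.
- move=> j; have := h3 j; rewrite /=; case: (up g j) => [[[[op i1] i2] it]|];
  by rewrite !upd_cell // !andbF.
by move=> j; rewrite upd_cell //= /set_at !andbT; case: eqP.
Qed.

Definition connect_mem (M : nat -> nat) (i op i1 i2 it : nat) : nat -> nat :=
  update (update (update (update M (cell i 0 + 8) op) (cell i 0 + 9) (cell i1 0))
    (cell i 0 + 10) (cell i2 0)) (cell i 0 + 11) (cell it 0).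

Lemma connect_memE M i op i1 i2 it j v f : v < X -> f < 16 ->
  connect_mem M i op i1 i2 it (cell j v + f) =
  if (j == i) && (v == 0) then
    match f with 8 => op | 9 => cell i1 0 | 10 => cell i2 0 | 11 => cell it 0
    | _ => M (cell j v + f) end
  else M (cell j v + f).
Proof.
move=> vX f16; have X0 := X_gt0; rewrite /connect_mem !upd_cell // !andbA.
case: ((j == i) && (v == 0)) => //=. by move: f f16; do 12 (case; first done) => //=.
Qed.

Lemma header_connect g M i op i1 i2 it : header_ok g M ->
  header_ok (set_up g i op i1 i2 it) (connect_mem M i op i1 i2 it).
Proof.
move=> [h1 h2 h3 h4]; have X0 := X_gt0; have EX := E_lt_X; split.
- move=> a Ha; rewrite /connect_mem !updN ?h1 //;
  by have := cell_base i 0 0; rewrite addn0; lia.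
- by move=> k kE; rewrite connect_memE //; [rewrite h2 // if_same|lia].
- move=> j; rewrite /= /set_at.
  case: eqP => [->|/eqP ne]; first by rewrite !connect_memE // !eqxx.
  have := h3 j; case: (up g j) => [[[[op' i1'] i2'] it']|];
  by rewrite !connect_memE // (negbTE ne).
by move=> j; rewrite connect_memE // h4 if_same.
Qed.

Lemma sat_inv_connect g D W s i op i1 i2 it : sat_inv g D W s ->
  sat_inv (set_up g i op i1 i2 it) D W (State (reg s) (connect_mem (memory s) i op i1 i2 it)).
Proof.
move=> [gl hd sl li sub]; split=> //=; first exact: header_connect.
  by apply: (@slots_extends g) => //; do 4 (apply: slots_write => //).
have WX : forall y, y \in W -> y.2 < X by move=> y /sub yD; have [] := s_bound sl yD.
by do 4 (apply: linked_write => //).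
Qed.

(** The bottom of the stack is unmarked: the postfix code of a tree never pops below its own
    operands, so emptiness is never tested. *)
Fixpoint stacked (M : nat -> nat) (a : nat) (stk : seq nat) : Prop :=
  if stk is i :: stk' then a = cell i 0 /\ stacked M (M (a + 13)) stk' else True.

Lemma eq_stacked M M' a stk :
  (forall i, i \in stk -> M' (cell i 0 + 13) = M (cell i 0 + 13)) ->
  stacked M a stk -> stacked M' a stk.
Proof.
elim: stk a => [|i stk IH] a //= H [-> st]; split=> //.
rewrite H ?mem_head //; apply: IH => // j jst; apply: H.
by rewrite inE jst orbT.
Qed.

(** * Invariants of the growing graph *)

Definition chain (g : graph) : nat -> nat -> Prop :=
  clos_refl_trans _ (fun i j => nxt g i = Some j).

Definition has_rule (g : graph) (op : nat) (t1 t2 : ltl (S + Nt)) (i : nat) : Prop :=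
  exists i1 i2, [/\ label g i1 = t1, label g i2 = t2,
    up g i1 = Some (op, i1, i2, i) & up g i2 = Some (op, i1, i2, i)].

Definition nt_site (Y : Nt) : nat := enum_rank Y.

(** What completeness asks of a site: each way in which its label can derive a formula is covered,
    by a filled slot for a letter, by the rule of the children for an operator, and by a chain from
    the nonterminal's own site for an occurrence. *)
Definition site_done (g : graph) (D : seq (nat * nat)) (i : nat) : Prop :=
  match label g i with
  | Atom (inl a) => (i, vector_of (Atom a)) \in D
  | Atom (inr Y) => chain g (nt_site Y) i
  | And t1 t2 => has_rule g 1 t1 t2 i
  | Or t1 t2 => has_rule g 2 t1 t2 i
  | Not t => has_rule g 3 t t i
  | Next t => has_rule g 4 t t i
  | Until t1 t2 => has_rule g 5 t1 t2 i
  end.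

(** Sites on the stack are roots of subtrees whose parent has not been read. They have no rule yet,
    so giving them one destroys nothing. [don] lists the productions already parsed. *)
Record graph_inv (g : graph) (stk : seq nat) (don : seq (Nt * ltl (S + Nt)))
    (D : seq (nat * nat)) : Prop := GraphInv {
  w_ok : graph_ok g;
  w_nt : forall Y, nt_site Y < nsites g /\ label g (nt_site Y) = Atom (inr Y);
  w_bound : forall i i1 i2 it op, up g i = Some (op, i1, i2, it) -> i < nsites g;
  w_site : forall i, i < nsites g -> site_done g D i;
  w_prod : forall Y t, List.In (Y, t) don -> exists r,
    [/\ r < nsites g, label g r = t & up g r = Some (6, r, r, nt_site Y)];
  w_stk : forall i, i \in stk -> i < nsites g /\ up g i = None;
  w_uniq : uniq stk }.

Lemma rule_ok_extends g g' op i1 i2 it : extends g g' ->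
  rule_ok g op i1 i2 it -> rule_ok g' op i1 i2 it.
Proof.
by move=> [n l] [a b c d]; split; rewrite ?l //; apply: leq_trans n.
Qed.

Lemma has_rule_mono g g' op t1 t2 i :
  (forall j, j < nsites g -> label g' j = label g j) ->
  (forall j x, up g j = Some x -> j < nsites g /\ up g' j = Some x) ->
  has_rule g op t1 t2 i -> has_rule g' op t1 t2 i.
Proof.
move=> Hl Hu [i1 [i2 [l1 l2 u1 u2]]]; exists i1, i2.
have [n1 u1'] := Hu _ _ u1; have [n2 u2'] := Hu _ _ u2.
by rewrite !Hl.
Qed.

(** Labels and rules persist, but inserting an occurrence subdivides a chain, so an old edge only
    has to become a path. *)
Lemma site_done_mono g g' D D' i :
  (forall j, j < nsites g -> label g' j = label g j) ->
  (forall j x, up g j = Some x -> j < nsites g /\ up g' j = Some x) ->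
  (forall j k, nxt g j = Some k -> chain g' j k) -> {subset D <= D'} ->
  i < nsites g -> site_done g D i -> site_done g' D' i.
Proof.
move=> Hl Hu Hn HD Hi; rewrite /site_done Hl //.
have hr op t1 t2 := @has_rule_mono g g' op t1 t2 i Hl Hu.
case: (label g i) => [[a|Y]|t1 t2|t1 t2|t|t|t1 t2]; [exact: HD| |exact: hr..].
elim=> [j k|j|j k l _ IH1 _ IH2]; [exact: Hn|exact: rt_refl|exact: rt_trans IH1 IH2].
Qed.

Lemma graph_inv_letter g stk don D a n :
  graph_inv g stk don D -> n = nsites g -> forall D', {subset D <= D'} ->
  (n, vector_of (Atom a)) \in D' ->
  graph_inv (add_site g (Atom (inl a))) (n :: stk) don D'.
Proof.
move=> [[ok1 ok2] nt bd st pr sk un] -> D' sub inD.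
have ext : extends g (add_site g (Atom (inl a))).
  by split=> //= i Hi; rewrite /set_at ltn_eqF.
split.
- by split=> *; apply: rule_ok_extends ext _; eauto.
- by move=> Y; have [lt l] := nt Y; split; [apply: ltnW | rewrite ext.2].
- by move=> i i1 i2 it op /= /bd /ltnW.
- move=> i; rewrite ltnS leq_eqVlt => /predU1P[->|lt].
    by rewrite /site_done /= /set_at eqxx.
  apply: site_done_mono (st _ lt) => //; first exact: ext.2.
    by move=> j [[[op i1] i2] it] u; split=> //; apply: bd u.
  by move=> j k; apply: rt_step.
- by move=> Y t /pr[r [lt l u]]; exists r; split=> //; [apply: ltnW | rewrite ext.2].
- move=> i; rewrite inE => /predU1P[->|/sk[lt u]]; last by split=> //; apply: ltnW.
  split=> //=; case Eu: (up g _) => [[[[op i1] i2] it]|] //.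
  by have := bd _ _ _ _ _ Eu; rewrite ltnn.
rewrite cons_uniq un andbT; apply/negP => /sk[].
by rewrite ltnn.
Qed.

(** The new occurrence is inserted directly behind the nonterminal's own site, in constant time and
    without walking along the chain. *)
Definition nt_graph (g : graph) (Y : Nt) : graph :=
  let n := nsites g in
  set_nxt (set_nxt (add_site g (Atom (inr Y))) n (nxt g (nt_site Y))) (nt_site Y) (Some n).

Lemma graph_inv_nt g stk don D Y n :
  graph_inv g stk don D -> n = nsites g -> 
  graph_inv (nt_graph g Y) (n :: stk) don D.
Proof.
move=> [[ok1 ok2] nt bd st pr sk un] ->.
have ext : extends g (nt_graph g Y).
  by split=> //= i Hi; rewrite /set_at ltn_eqF.
have [ltY lY] := nt Y.
have nY : nsites g == nt_site Y = false by rewrite gtn_eqF.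
have ln : label (nt_graph g Y) (nsites g) = Atom (inr Y) by rewrite /= /set_at eqxx.
have nxtg' j : nxt (nt_graph g Y) j = if j == nt_site Y then Some (nsites g)
  else if j == nsites g then nxt g (nt_site Y) else nxt g j by [].
have rY j : nxt g (nt_site Y) = Some j -> rule_ok (nt_graph g Y) 6 (nsites g) (nsites g) j.
  move=> /ok2/(rule_ok_extends ext)[a b c [[//]|[_ d]]]; split; [exact: ltnSn|exact: ltnSn|exact: c|].
  right; split=> // phi; rewrite ln => H; apply: d.
  by rewrite ext.2 ?lY.
split.
- split=> [i op i1 i2 it /ok1|i j]; first exact: rule_ok_extends.
  rewrite nxtg'; case: eqP => [-> [<-]|_].
    split; [exact: ltnW|exact: ltnW|exact: ltnSn|right; split=> // phi].
    by rewrite ln ext.2 ?lY.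
  by case: eqP => [-> /rY|_ /ok2/(rule_ok_extends ext)].
- by move=> Z; have [lt l] := nt Z; split; [apply: ltnW | rewrite ext.2].
- by move=> i i1 i2 it op /= /bd /ltnW.
- have edge : chain (nt_graph g Y) (nt_site Y) (nsites g).
    by apply: rt_step; rewrite nxtg' eqxx.
  move=> i; rewrite ltnS leq_eqVlt => /predU1P[->|lt].
    by rewrite /site_done ln.
  apply: site_done_mono (st _ lt) => //; first exact: ext.2.
    by move=> j [[[op i1] i2] it] u; split=> //; apply: bd u.
  (* The only edge that changes leaves [nt_site Y]; it is now a path of two edges through the new
     site. *)
  move=> j k Hjk; case: (altP (j =P nt_site Y)) => [E0|ne].
    rewrite E0 in Hjk *; apply: rt_trans edge _; apply: rt_step.
    by rewrite nxtg' nY eqxx.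
  apply: rt_step; rewrite nxtg' (negbTE ne).
  by have [jn _ _ _] := ok2 _ _ Hjk; rewrite ltn_eqF.
- by move=> Z t /pr[r [lt l u]]; exists r; split=> //; [apply: ltnW | rewrite ext.2].
- move=> i; rewrite inE => /predU1P[->|/sk[lt u]]; last by split=> //; apply: ltnW.
  split=> //=; case Eu: (up g _) => [[[[op i1] i2] it]|] //.
  by have := bd _ _ _ _ _ Eu; rewrite ltnn.
rewrite cons_uniq un andbT; apply/negP => /sk[].
by rewrite ltnn.
Qed.

Definition op_graph (g : graph) (op i1 i2 : nat) : graph :=
  let n := nsites g in
  set_up (set_up (add_site g (mk_op op (label g i1) (label g i2))) i1 op i1 i2 n) i2 op i1 i2 n.

(** Unary and binary operators are treated together: a unary rule names its source twice, and then
    only one entry is popped. The right operand is on top because the code is postfix. *)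
Lemma graph_inv_op g stk don D op i1 i2 n :
  graph_inv g (i2 :: (if i1 == i2 then stk else i1 :: stk)) don D -> n = nsites g ->
  0 < op < 6 -> (2 < op < 5 -> i1 = i2) ->
  graph_inv (op_graph g op i1 i2) (n :: stk) don D.
Proof.
move=> [[ok1 ok2] nt bd st pr sk un] -> op6 opu; set g' := op_graph _ _ _ _.
have ext : extends g g'.
  by split=> //= i Hi; rewrite /set_at ltn_eqF.
have [lt2 u2] := sk i2 (mem_head _ _).
have [lt1 u1] : i1 < nsites g /\ up g i1 = None.
  by apply: sk; case: eqP => [->|_]; rewrite !inE eqxx ?orbT.
have skst i : i \in stk -> [/\ i < nsites g, up g i = None, i != i1 & i != i2].
  move=> ist; have [lt u] : i < nsites g /\ up g i = None.
    by apply: sk; rewrite inE; case: ifP; rewrite ?inE ist !orbT.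
  split=> //.
    move: un; case: eqP => [->|_] /=; first by case/andP => H _; apply: contraNneq H => <-.
    by case/and3P=> _ H _; apply: contraNneq H => <-.
  move: un; rewrite cons_uniq => /andP[H _]; apply: contraNneq H => <-.
  by case: ifP; rewrite ?inE ist ?orbT.
have newup : up g (nsites g) = None.
  case Eu: (up g _) => [[[[o j1] j2] it]|] //.
  by have := bd _ _ _ _ _ Eu; rewrite ltnn.
have upg' j : up g' j = if (j == i1) || (j == i2) then Some (op, i1, i2, nsites g) else up g j.
  by rewrite /g' /= /set_at; case: (j == i2); case: (j == i1).
have lab_n : label g' (nsites g) = mk_op op (label g i1) (label g i2).
  by rewrite /g' /= /set_at eqxx.
have new_ok : rule_ok g' op i1 i2 (nsites g).
  split; [exact: ltnW|exact: ltnW|exact: ltnSn|left; split=> //; by rewrite (ext.2 i1) // (ext.2 i2)].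
split.
- split=> [i o j1 j2 it|i j /ok2]; last exact: rule_ok_extends.
  by rewrite upg'; case: ifP => [_ [<- <- <- <-] //|_ /ok1]; apply: rule_ok_extends.
- by move=> Z; have [lt l] := nt Z; split; [apply: ltnW | rewrite ext.2].
- move=> i j1 j2 it o; rewrite upg'; case: ifP => [/orP[]/eqP-> _|_ /bd]; exact: ltnW.
- move=> i; rewrite ltnS leq_eqVlt => /predU1P[->|lt].
    have hr : has_rule g' op (label g i1) (label g i2) (nsites g).
      by exists i1, i2; rewrite !upg' !eqxx orbT !ext.2.
    rewrite /site_done lab_n.
    have: op \in [:: 1; 2; 3; 4; 5] by rewrite !inE; lia.
    rewrite !inE => /or4P[|||/orP[]]/eqP op_eq; move: hr; rewrite op_eq //= opu // op_eq //.
  apply: site_done_mono (st _ lt) => //; first exact: ext.2.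
    move=> j [[[o j1] j2] it] u; split; first exact: bd u.
    rewrite upg'; case: ifP => // /orP[]/eqP E0; move: u; rewrite E0 ?u1 ?u2 //.
  by move=> j k; apply: rt_step.
- move=> Z t /pr[r [lt l u]]; exists r; split=> //; [exact: ltnW | by rewrite ext.2|].
  rewrite upg'; case: ifP => // /orP[]/eqP E0; move: u; rewrite E0 ?u1 ?u2 //.
- move=> i; rewrite inE => /predU1P[->|/skst[lt u n1 n2]].
    split=> //; rewrite upg' newup !gtn_eqF //.
  split; first exact: ltnW.
  by rewrite upg' (negbTE n1) (negbTE n2).
rewrite cons_uniq; apply/andP; split.
  by apply/negP => /skst[]; rewrite ltnn.
by move: un; case: ifP => _ /=; [case/andP | case/and3P].
Qed.

Lemma graph_inv_prod g r stk don D Y t :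
  graph_inv g (r :: stk) don D -> label g r = t -> List.In (Y, t) (productions G) ->
  graph_inv (set_up g r 6 r r (nt_site Y)) stk (rcons don (Y, t)) D.
Proof.
move=> [[ok1 ok2] nt bd st pr sk un] lr inG; set g' := set_up _ _ _ _ _ _.
have [ltr ur] := sk r (mem_head _ _).
have [ltY lY] := nt Y.
have upg' j : up g' j = if j == r then Some (6, r, r, nt_site Y) else up g j by [].
have keep j x : up g j = Some x -> up g' j = Some x.
  by rewrite upg'; case: eqP => // ->; rewrite ur.
split=> //.
- split=> [i o j1 j2 it|i j /ok2 //].
  rewrite upg'; case: ifP => [_ [<- <- <- <-]|_ /ok1 //].
  split=> //; right; split=> //= phi; rewrite lY lr.
  exact: derives_production.
- by move=> i j1 j2 it o; rewrite upg'; case: eqP => [-> //|_ /bd].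
- move=> i lt; apply: site_done_mono (st _ lt) => //.
    by move=> j [[[o j1] j2] it] u; split; [apply: bd u | apply: keep].
  by move=> j k; apply: rt_step.
- move=> Z u; rewrite -cats1 => inr.
  have [/pr[q [lt l uq]]|[[<- <-]|//]] := List.in_app_or _ _ _ inr.
    by exists q; split=> //; apply: keep.
  by exists r; rewrite upg' eqxx.
- move=> i ist; have /sk[lt u] : i \in r :: stk by rewrite inE ist orbT.
  split=> //; rewrite upg' ifF //; move: un; rewrite cons_uniq => /andP[H _].
  by apply: contraNF H => /eqP <-.
by move: un => /andP[].
Qed.

(** * Parsing right-hand sides into sites *)

Definition nt_addr_prog : prog := (
  64 <~ $62;; 65 <~ $90;;
  While ($65) (64 <~ $64 + $64;; 65 <~ $65 - #1);;
  64 <~ $92 + times16 ($64))%P.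

(** The site index is multiplied by [X = 2 ^ E] through [E] doublings. *)
Lemma run_nt_addr s : globals E base s ->
  run nt_addr_prog s (40 * X) (fun s' =>
    [/\ reg s' 64 = cell (reg s 62) 0, memory s' = memory s &
        forall r, r != 64 -> r != 65 -> reg s' r = reg s r]).
Proof.
move=> [gE _ gb]; have EX := E_lt_X.
apply: run_le.
  do 2 (apply: run_seq; apply: run_setreg => /=).
  apply: run_seq; apply: (run_imp (P := fun s' =>
    [/\ reg s' 64 = reg s 62 * X, memory s' = memory s &
        forall r, r != 64 -> r != 65 -> reg s' r = reg s r])).
    apply: (run_while (n := E) (I := fun j s' =>
      [/\ reg s' 65 = j, j <= E, reg s' 64 = reg s 62 * 2 ^ (E - j), memory s' = memory s &
        forall r, r != 64 -> r != 65 -> reg s' r = reg s r])).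
    - by upd; rewrite subnn muln1 gE; split=> // r *; rewrite !ifF //; lia.
    - by move=> j s1 [e65 jE e64 m fr] /= j0; rewrite e64 -e65 j0 subn0.
    move=> j s1 [e65 jE e64 m fr] /= j0; split; first lia.
    apply: run_seq; apply: run_setreg; apply: run_setreg; upd; split=> //; try lia.
      by rewrite e64 (_ : E - j.-1 = (E - j).+1); [rewrite expnS; lia|lia].
    by move=> r r64 r65; rewrite !ifF ?fr //; lia.
  move=> s1 [e64 m fr]; apply: run_setreg; rewrite /= !updE e64 (fr 92) // gb /cell.
  by split=> //; [lia | move=> r r64 r65; rewrite updN ?fr].
rewrite /= -/X; nia.
Qed.

Definition connect_prog (r : nat) : prog := (
  $r + #8 ::= $67;; $r + #9 ::= $72;; $r + #10 ::= $73;; $r + #11 ::= $66)%P.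

Lemma run_connect r s i op i1 i2 it (Q : state -> Prop) :
  reg s r = cell i 0 -> reg s 67 = op -> reg s 72 = cell i1 0 ->
  reg s 73 = cell i2 0 -> reg s 66 = cell it 0 ->
  Q (State (reg s) (connect_mem (memory s) i op i1 i2 it)) ->
  run (connect_prog r) s 20 Q.
Proof.
move=> er e67 e72 e73 e66 HQ.
apply: run_le.
  do 3 (apply: run_seq; apply: run_setmem => /=); apply: run_setmem.
  by rewrite /= er e67 e72 e73 e66.
by [].
Qed.

(* Registers: 60 input pointer, 66 new site, 67 tag, 70 first free site, 71 top
   of the parsing stack, 72 and 73 the operands. *)
Definition node_prog : prog := (
  66 <~ $70;; 70 <~ $70 + times16 ($91);; 67 <~ @[$60];;
  If ($67)
    (If ($67 - #5)
      (62 <~ @[$60 + #1];; nt_addr_prog;;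
       $66 + #12 ::= @[$64 + #12];; $64 + #12 ::= $66;; $66 + #13 ::= $71)
      (73 <~ $71;; 72 <~ $71;;
       If ($67 - #2)
         (If ($67 - #4) (72 <~ @[$71 + #13]) Skip)
         (72 <~ @[$71 + #13]);;
       connect_prog 72;; connect_prog 73;;
       $66 + #13 ::= @[$72 + #13]))
    (20 <~ #0;; 21 <~ @[$60 + #1];; 22 <~ #0;; vector_prog;;
     30 <~ $66;; 31 <~ #0;; 32 <~ @[$60 + #1];; insert_prog;;
     $66 + #13 ::= $71);;
  71 <~ $66;; 60 <~ $60 + #2)%P.

(** Nothing is taken from the worklist during parsing, so filled and pending slots coincide: [D]
    occurs twice in [sat_inv]. *)
Definition parse_inv (g : graph) (stk : seq nat) (don : seq (Nt * ltl (S + Nt)))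
    (D : seq (nat * nat)) (s : state) : Prop :=
  [/\ sat_inv g D D s, reg s 70 = cell (nsites g) 0,
      stacked (memory s) (reg s 71) stk & graph_inv g stk don D].

Definition kept (s s' : state) : Prop :=
  [/\ reg s' 61 = reg s 61, reg s' 63 = reg s 63 & reg s' 68 = reg s 68].

Definition after_node (g : graph) (stk : seq nat) (don : seq (Nt * ltl (S + Nt)))
    (s s' : state) : Prop :=
  exists D, [/\ parse_inv g stk don D s', reg s' 60 = reg s 60 + 2 & kept s s'].

Lemma cellS i : cell i 0 + 16 * X = cell i.+1 0.
Proof. rewrite /cell; lia. Qed.

Lemma sat_inv_add g t D W s : sat_inv g D W s -> sat_inv (add_site g t) D W s.
Proof.
move=> [gl hd sl li sub]; split=> //; first by case: hd.
by apply: slots_extends sl; split=> //= i Hi; rewrite /set_at ltn_eqF.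
Qed.

Lemma run_node_shell g D s (Q : state -> Prop) (c : prog) B :
  sat_inv g D D s -> reg s 70 = cell (nsites g) 0 ->
  (forall s1, sat_inv g D D s1 -> memory s1 = memory s -> reg s1 66 = cell (nsites g) 0 ->
     reg s1 70 = cell (nsites g).+1 0 -> reg s1 67 = memory s (reg s 60) ->
     reg s1 60 = reg s 60 -> reg s1 71 = reg s 71 -> kept s s1 ->
     run c s1 B (fun s2 => Q (State (update (update (reg s2) 71 (reg s2 66)) 60 (reg s2 60 + 2)) (memory s2)))) ->
  run (66 <~ $70;; 70 <~ $70 + times16 ($91);; 67 <~ @[$60];; c;; 71 <~ $66;; 60 <~ $60 + #2)%P
    s (B + 100) Q.
Proof.
move=> inv e70 Hc; apply: run_le.
  have [_ g91 _] := i_globals inv.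
  apply: run_seq; apply: run_setreg => /=.
  apply: run_seq; apply: run_setreg.
  rewrite (_ : eval _ _ = cell (nsites g).+1 0); last first.
    by rewrite /= !updN // e70 g91 -cellS -/X; lia.
  apply: run_seq; apply: run_setreg; rewrite /= !updN //.
  apply: run_seq; apply: run_imp (Hc _ _ _ _ _ _ _ _ _) _ => //=.
  - by apply: sat_inv_regs inv _ _ => //= r Hr; rewrite !updN //; lia.
  move=> s2 HQ; apply: run_seq; apply: run_setreg; apply: run_setreg => /=.
  by rewrite [update (reg s2) 71 _ 60]updN.
rewrite /=; lia.
Qed.

Lemma fresh_stack g stk don D : graph_inv g stk don D -> nsites g \notin stk.
Proof. by move=> w; apply/negP => /(w_stk w)[]; rewrite ltnn. Qed.

(** Letters are the only nodes that fill a slot during parsing; these slots are the seeds of the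
    fixpoint. *)
Lemma run_node_letter g stk don D s a : parse_inv g stk don D s ->
  M0 (reg s 60) = 0 -> M0 (reg s 60 + 1) = enum_rank a -> reg s 60 + 1 < base ->
  run node_prog s (1500 * X ^ 3) (after_node (add_site g (Atom (inl a))) (nsites g :: stk) don s).
Proof.
move=> [inv e70 st gi] tag arg lt; have X0 := X_gt0.
have inp := h_input (i_header inv); have lt0 : reg s 60 < base by lia.
apply: run_le.
  apply: (run_node_shell inv e70) => s1 inv1 m1 e66 e70' e67 e60 e71 [k1 k2 k3].
  apply: (run_if (B1 := 0)) => /= [H|_]; first by rewrite e67 inp ?tag // in H.
  do 3 (apply: run_seq; apply: run_setreg => /=); upd; rewrite e60 m1 inp // arg.
  apply: run_seq; apply: (run_imp (run_vector (base := base) (M0 := M0) J_le _ _ _)) => //=.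
  - by rewrite -m1; case: (i_globals inv1).
  - exact: header_lasso (i_header inv).
  move=> s2 [e23 m2 fr2 _].
  do 3 (apply: run_seq; apply: run_setreg => /=); upd.
  rewrite m2 !fr2 //= e66 e60 inp // arg.
  set g' := add_site _ _.
  set s3 := State _ _.
  have inv3 : sat_inv g' D D s3.
    apply: sat_inv_add; apply: sat_inv_regs inv1 _ _; rewrite /= ?m2 ?m1 // => r Hr.
    by regs_at r.
  have mn : memory s3 = memory s by [].
  apply: run_seq; apply: (run_imp (run_insert (w := vector_of (Atom a)) (i := nsites g)
    (phi := Atom a) inv3 _ _ _ _ _ _ _)) => //.
  - exact: vector_of_lt.
  - by rewrite /= /set_at eqxx; constructor.
  move=> s4 [new [inv4 in4 sh4 fr4]].
  have fr4' r : 25 <= r -> r \notin [:: 30; 31; 32; 34; 80] -> reg s4 r = reg s1 r.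
    move=> Hr; rewrite !inE !negb_or => /and5P[n1 n2 n3 n4 n5].
    by rewrite fr4 // /s3 /=; regs_at r.
  apply: run_setmem => /=; rewrite !fr4' // e66 e60 e71.
  have nstk := fresh_stack gi.
  exists (new ++ D); split; [split=> //=|by []|by split; rewrite /= fr4'].
  - apply: (@sat_inv_regs _ _ _ (State (reg s4) (update (memory s4) (cell (nsites g) 0 + 13) (reg s 71)))) => //.
      by apply: sat_inv_write (inv4) _ _ => //; apply: header_write13 (i_header inv4).
    by move=> r Hr; rewrite /= !ifF //; lia.
  - by rewrite fr4'.
  - split=> //; rewrite updE.
    apply: eq_stacked st => i ist; rewrite upd_cell // andbT (negbTE (memPn nstk _ ist)) /=.
    by case: sh4 => _ ->; rewrite // mn.
  - apply: graph_inv_letter gi erefl _ _ in4 => x xD.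
    by rewrite mem_cat xD orbT.
rewrite /= -/X; have : 0 < X ^ 3 by rewrite expn_gt0 X0.
rewrite 2!expnS expn1; nia.
Qed.

Lemma run_node_nt g stk don D s Y : parse_inv g stk don D s ->
  M0 (reg s 60) = 6 -> M0 (reg s 60 + 1) = enum_rank Y -> reg s 60 + 1 < base ->
  run node_prog s (1500 * X ^ 3) (after_node (nt_graph g Y) (nsites g :: stk) don s).
Proof.
move=> [inv e70 st gi] tag arg lt; have X0 := X_gt0.
have inp := h_input (i_header inv); have lt0 : reg s 60 < base by lia.
apply: run_le.
  apply: (run_node_shell inv e70) => s1 inv1 m1 e66 e70' e67 e60 e71 [k1 k2 k3].
  apply: (run_if (B2 := 0)) => /= [_|H]; last by rewrite e67 inp ?tag // in H.
  apply: (run_if (B2 := 0)) => /= [_|H]; last by rewrite e67 inp ?tag // in H.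
  apply: run_seq; apply: run_setreg => /=; rewrite e60 m1 inp // arg.
  apply: run_seq; apply: (run_imp (run_nt_addr _)); first by case: (i_globals inv1).
  rewrite /= updE => s2 [e64 m2 fr2].
  have {}fr2 r : 60 <= r -> r \notin [:: 62; 64; 65] -> reg s2 r = reg s1 r.
    move=> Hr; rewrite !inE !negb_or => /and3P[n2 n4 n5].
    by rewrite fr2 ?updN.
  have inv2 : sat_inv (add_site g (Atom (inr Y))) D D s2.
    apply: sat_inv_add; apply: sat_inv_regs inv1 _ _; first by rewrite m2 m1.
    by move=> r Hr; rewrite fr2 // ?inE; lia.
  rewrite -/(nt_site Y) in e64 *.
  do 2 (apply: run_seq; apply: run_setmem => /=); apply: run_setmem => /=.
  rewrite e64 !fr2 // e66 e71 e60 m2.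
  have nY : nt_site Y < nsites g by have [] := w_nt gi Y.
  have hd2 := i_header inv2; rewrite m2 in hd2.
  have Y12 : memory s (cell (nt_site Y) 0 + 12) = if nxt g (nt_site Y) is Some j then cell j 0 else 0.
    exact: (h_nxt hd2).
  rewrite Y12.
  (* [M1] and [M2] splice the new site into the chain, and [M3] pushes it on the parsing stack. *)
  set M1 := update (memory s) _ _; set M2 := update M1 _ _; set M3 := update M2 _ _.
  have inv3 : sat_inv (nt_graph g Y) D D (State (reg s2) M3).
    have hd3 := header_write12 (nsites g) (nxt g (nt_site Y)) hd2.
    have hd4 := header_write12 (nt_site Y) (Some (nsites g)) hd3.
    have hd5 := header_write13 (nsites g) (reg s 71) hd4.
    have := sat_inv_write (i := nsites g) (f := 12) (s := s2) _ inv2 _ _; rewrite m2 => H1.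
    have {}H1 := H1 _ _ erefl _ hd3.
    have H2 := sat_inv_write (i := nt_site Y) (f := 12) erefl (H1 _) _ hd4.
    have H3 := sat_inv_write (i := nsites g) (f := 13) erefl (H2 _ _) _ hd5.
    by apply: H3.
  have nstk := fresh_stack gi.
  upd; exists D; split; [split=> //=|by []|by split; rewrite /= fr2].
  - apply: (sat_inv_regs inv3) => // r Hr; by rewrite /= !ifF //; lia.
  - by rewrite fr2.
  - split=> //; rewrite {2}/M3 updE.
    apply: eq_stacked st => i ist.
    by rewrite /M3 /M2 /M1 !upd_cell // andbT (negbTE (memPn nstk _ ist)) !andbF.
  - exact: graph_inv_nt gi erefl.
rewrite /= -/X; have : 0 < X ^ 3 by rewrite expn_gt0 X0.
rewrite 2!expnS expn1; nia.
Qed.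

Lemma run_node_op g stk don D s op i1 i2 : 
  parse_inv g (i2 :: (if i1 == i2 then stk else i1 :: stk)) don D s ->
  M0 (reg s 60) = op -> reg s 60 + 1 < base -> 0 < op < 6 -> (i1 == i2) = (2 < op < 5) ->
  run node_prog s (1500 * X ^ 3) (after_node (op_graph g op i1 i2) (nsites g :: stk) don s).
Proof.
move=> [inv e70 st gi] tag lt op6 opi; have X0 := X_gt0.
have inp := h_input (i_header inv); have lt0 : reg s 60 < base by lia.
have [st2 st1] : reg s 71 = cell i2 0 /\ (i1 != i2 -> memory s (cell i2 0 + 13) = cell i1 0) /\
   stacked (memory s) (memory s (cell i1 0 + 13)) stk.
  move: st => /= [->]; case: eqP => [->|_] /=; first by split.
  by case=> ->.
case: st1 => st1 st0.
apply: run_le.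
  apply: (run_node_shell inv e70) => s1 inv1 m1 e66 e70' e67 e60 e71 [k1 k2 k3].
  rewrite inp // tag in e67.
  apply: (run_if (B2 := 0)) => /= [_|H]; last by move: op6; rewrite -e67 H.
  apply: (run_if (B1 := 0)) => /= [H|_]; first by move: op6 H; rewrite -e67; lia.
  do 2 (apply: run_seq; apply: run_setreg => /=); upd.
  rewrite e71 st2.
  apply: run_seq; apply: (run_imp (P := fun s' => [/\ memory s' = memory s,
    reg s' 72 = cell i1 0, reg s' 73 = cell i2 0 &
    forall r, 60 <= r -> r \notin [:: 72; 73] -> reg s' r = reg s1 r])).
    have fr a b : forall r, 60 <= r -> r \notin [:: 72; 73] ->
       (if r == 72 then a else if r == 73 then b else reg s1 r) = reg s1 r.
      by move=> r _; rewrite !inE negb_or => /andP[/negbTE -> /negbTE ->].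
    have two : 2 < op < 5 \/ i1 != i2 by rewrite opi; lia.
    have bin : i1 != i2 -> run (72 <~ @[$71 + #13])%P
     (State (fun j => if j == 72 then cell i2 0 else if j == 73 then cell i2 0 else reg s1 j) (memory s1))
      5 (fun s' => [/\ memory s' = memory s, reg s' 72 = cell i1 0, reg s' 73 = cell i2 0 &
    forall r, 60 <= r -> r \notin [:: 72; 73] -> reg s' r = reg s1 r]).
      move=> /st1 ne; apply: run_setreg; upd; rewrite e71 st2 m1 ne; split=> // r Hr.
      rewrite !inE negb_or => /andP[/negbTE -> /negbTE ->] //.
    apply: run_if; rewrite /= e67 => H2; last by apply: bin; rewrite opi; lia.
    apply: run_if; rewrite /= e67 => H4; first by apply: bin; rewrite opi; lia.
    apply: run_skip; split=> //=; last exact: fr.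
    by have /eqP -> : i1 == i2 by rewrite opi; lia.
  move=> s2 [m2 e72 e73 fr2].
  have inv2 : sat_inv (add_site g (mk_op op (label g i1) (label g i2))) D D s2.
    apply: sat_inv_add; apply: sat_inv_regs inv1 _ _; first by rewrite m2.
    by move=> r Hr; rewrite fr2 // ?inE; lia.
  have r66 : reg s2 66 = cell (nsites g) 0 by rewrite fr2.
  have r67 : reg s2 67 = op by rewrite fr2.
  have inv3 := sat_inv_connect i1 op i1 i2 (nsites g) inv2.
  have inv4 := sat_inv_connect i2 op i1 i2 (nsites g) inv3.
  apply: run_seq; apply: (run_connect e72 r67 e72 e73 r66).
  apply: run_seq; apply: (@run_connect _ (State (reg s2) _) _ _ _ _ _ _ e73 r67 e72 e73 r66).
  have nstk := fresh_stack gi.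
  have M13 j : (connect_mem (connect_mem (memory s2) i1 op i1 i2 (nsites g)) i2 op i1 i2 (nsites g))
     (cell j 0 + 13) = memory s (cell j 0 + 13).
    by rewrite !connect_memE // !if_same m2.
  apply: run_setmem => /=.
  rewrite r66 e72 M13; set M := update _ _ (memory s _); upd.
  exists D; split; [split=> //=|by rewrite fr2 // e60|by split; rewrite /= fr2].
  - apply: sat_inv_regs (sat_inv_write (i := nsites g) (f := 13) erefl inv4 _ _) _ _ => //.
      exact: header_write13 (i_header inv4).
    by move=> r Hr; rewrite /= !ifF //; lia.
  - by rewrite fr2.
  - split=> //; rewrite {2}/M updE; apply: eq_stacked st0 => i ist.
    rewrite /M upd_cell // M13 andbT ifF //; apply: contraTF ist => /eqP ->.
    by apply: contra nstk; rewrite inE; case: ifP; rewrite ?inE => _ ->; rewrite ?orbT.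
  - by apply: (graph_inv_op gi) => // /(eq_trans opi)/eqP.
rewrite /= -/X; have : 0 < X ^ 3 by rewrite expn_gt0 X0.
rewrite 2!expnS expn1; nia.
Qed.

Definition tree_loop : prog := (While ($63) (63 <~ $63 - #1;; node_prog))%P.

Lemma parse_inv_regs g stk don D s s' : parse_inv g stk don D s ->
  memory s' = memory s -> (forall r, 80 <= r -> reg s' r = reg s r) ->
  reg s' 70 = reg s 70 -> reg s' 71 = reg s 71 -> parse_inv g stk don D s'.
Proof.
move=> [inv e70 st gi] m fr e70' e71; split; rewrite ?e70' ?e71 ?m //.
exact: sat_inv_regs inv m fr.
Qed.

Lemma run_tree_step g stk don D g' stk' don' s n B (Q : state -> Prop) :
  parse_inv g stk don D s -> reg s 63 = n.+1 ->
  (forall s1, parse_inv g stk don D s1 -> reg s1 60 = reg s 60 ->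
     run node_prog s1 (1500 * X ^ 3) (after_node g' stk' don' s1)) ->
  (forall s2 D', parse_inv g' stk' don' D' s2 -> reg s2 60 = reg s 60 + 2 ->
     reg s2 61 = reg s 61 -> reg s2 63 = n -> reg s2 68 = reg s 68 ->
     run tree_loop s2 B Q) ->
  run tree_loop s (1600 * X ^ 3 + B) Q.
Proof.
move=> inv e63 Hn Hk; have X3 : 0 < X ^ 3 by rewrite expn_gt0 X_gt0.
apply: run_le.
  apply: run_while_step; first by rewrite /= e63.
  apply: run_seq; apply: run_setreg => /=; upd; rewrite e63 subn1 /=.
  apply: (run_imp (Hn _ _ _)) => //.
    by apply: parse_inv_regs inv _ _ _ _ => //= r Hr; rewrite ifF //; lia.
  by move=> s2 [D' [inv2 e60 [e61 e63' e68]]]; apply: (Hk _ _ inv2).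
rewrite /=; lia.
Qed.

Definition after_tree g stk don (t : ltl (S + Nt)) n (s s' : state) : Prop :=
  exists g' i D', [/\ parse_inv g' (i :: stk) don D' s', extends g g',
    label g' i = t, nsites g' = nsites g + ltl_size t &
    [/\ reg s' 63 = n, reg s' 60 = reg s 60 + 2 * ltl_size t,
        reg s' 61 = reg s 61 & reg s' 68 = reg s 68]].

(** The program is one flat loop over postfix code, whereas the proof is an induction on the tree.
    The specification is therefore in continuation style: what the loop does after the nodes of [t]
    is the hypothesis on [run tree_loop s' B Q], and [n] counts the nodes left for it. *)
Definition tree_spec (t : ltl (S + Nt)) : Prop := forall g stk don D s n B Q,
  parse_inv g stk don D s -> reg s 63 = ltl_size t + n ->
  holds_at M0 (reg s 60) (encode_tree t) -> reg s 60 + 2 * ltl_size t <= base ->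
  (forall s', after_tree g stk don t n s s' -> run tree_loop s' B Q) ->
  run tree_loop s (1600 * X ^ 3 * ltl_size t + B) Q.

Lemma extends_add g t : extends g (add_site g t).
Proof. by split=> //= i Hi; rewrite /set_at ltn_eqF. Qed.

Lemma tree_spec_binary op t1 t2 : op \in [:: 1; 2; 5] -> tree_spec t1 -> tree_spec t2 ->
  encode_tree (mk_op op t1 t2) = encode_tree t1 ++ encode_tree t2 ++ [:: op; 0] ->
  ltl_size (mk_op op t1 t2) = (ltl_size t1 + ltl_size t2).+1 ->
  tree_spec (mk_op op t1 t2).
Proof.
move=> opb T1 T2 Ee Es g stk don D s n B Q inv.
rewrite Ee Es => e63; rewrite !holds_at_cat !size_encode_tree => -[h1 [h2 h3]] le HQ.
apply: run_le.
  apply: (T1 _ _ _ _ _ (ltl_size t2 + n.+1)) inv _ h1 _ _; [lia|lia|].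
  move=> s1 [g1 [i1 [D1 [inv1 ext1 l1 n1 [f63 f60 f61 f68]]]]].
  have lt1 : i1 < nsites g1 by have [_ _ _ gi1] := inv1; have [] := w_stk gi1 (mem_head _ _).
  apply: (T2 _ _ _ _ _ n.+1) inv1 f63 _ _ _; rewrite ?f60 //; first lia.
  move=> s2 [g2 [i2 [D2 [inv2 ext2 l2 n2 [k63 k60 k61 k68]]]]].
  (* The stack has no repetitions, so the two operands differ; this is how the invariant tells a
     binary node from a unary one. *)
  have [_ _ _ gi2] := inv2; have := w_uniq gi2; rewrite /= inE negb_or => /and3P[/andP[ne _] _ _].
  have ne' : (i1 == i2) = false by rewrite eq_sym; apply: negbTE.
  move/holds_at_cons: h3 => [tag _].
  apply: (run_tree_step (g' := op_graph g2 op i1 i2) (stk' := nsites g2 :: stk) (don' := don) inv2 k63).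
    move=> s3 inv3 e60; apply: run_node_op; rewrite ?ne' ?e60 ?k60 ?f60 //;
      try exact: inv3; by move: opb; rewrite !inE; lia.
  move=> s3 D3 inv3 m60 m61 m63 m68; apply: HQ.
  have ext3 : extends g2 (op_graph g2 op i1 i2) by apply: extends_add.
  exists (op_graph g2 op i1 i2), (nsites g2), D3; split=> //.
  - exact: extends_trans (extends_trans ext1 ext2) ext3.
  - by rewrite /= /set_at eqxx l2 ext2.2 // l1.
  - by rewrite /= n2 n1; lia.
  - by rewrite m60 m61 m68 k60 k61 k68 f60 f61 f68; split=> //; lia.
lia.
Qed.

Lemma tree_spec_unary op t : op \in [:: 3; 4] -> tree_spec t ->
  encode_tree (mk_op op t t) = encode_tree t ++ [:: op; 0] ->
  ltl_size (mk_op op t t) = (ltl_size t).+1 ->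
  tree_spec (mk_op op t t).
Proof.
move=> opb T1 Ee Es g stk don D s n B Q inv.
rewrite Ee Es => e63; rewrite !holds_at_cat !size_encode_tree => -[h1 h3] le HQ.
apply: run_le.
  apply: (T1 _ _ _ _ _ n.+1) inv _ h1 _ _; [lia|lia|].
  move=> s2 [g2 [i2 [D2 [inv2 ext2 l2 n2 [k63 k60 k61 k68]]]]].
  move/holds_at_cons: h3 => [tag _].
  apply: (run_tree_step (g' := op_graph g2 op i2 i2) (stk' := nsites g2 :: stk) (don' := don) inv2 k63).
    move=> s3 inv3 e60; apply: run_node_op; rewrite ?eqxx ?e60 ?k60 //;
      try exact: inv3; by move: opb; rewrite !inE; lia.
  move=> s3 D3 inv3 m60 m61 m63 m68; apply: HQ.
  have ext3 : extends g2 (op_graph g2 op i2 i2) by apply: extends_add.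
  exists (op_graph g2 op i2 i2), (nsites g2), D3; split=> //.
  - exact: extends_trans ext2 ext3.
  - by rewrite /= /set_at eqxx l2.
  - by rewrite /= n2; lia.
  - by rewrite m60 m61 m68 k60 k61 k68; split=> //; lia.
lia.
Qed.

Lemma run_tree t : tree_spec t.
Proof.
elim: t => [[a|Y]|t1 T1 t2 T2|t1 T1 t2 T2|t T|t T|t1 T1 t2 T2].
- move=> g stk don D s n B Q inv e63 /holds_at_cons[tag /holds_at_cons[arg _]] le HQ.
  rewrite muln1; apply: (run_tree_step (g' := add_site g (Atom (inl a))) inv e63).
    move=> s1 inv1 e60; apply: run_node_letter inv1 _ _ _; rewrite e60 //; move: le => /=; lia.
  move=> s2 D2 inv2 m60 m61 m63 m68; apply: HQ.
  exists (add_site g (Atom (inl a))), (nsites g), D2; split=> //=.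
  - exact: extends_add.
  - by rewrite /set_at eqxx.
  - by rewrite addn1.
- move=> g stk don D s n B Q inv e63 /holds_at_cons[tag /holds_at_cons[arg _]] le HQ.
  rewrite muln1; apply: (run_tree_step (g' := nt_graph g Y) inv e63).
    move=> s1 inv1 e60; apply: run_node_nt inv1 _ _ _; rewrite e60 //; move: le => /=; lia.
  move=> s2 D2 inv2 m60 m61 m63 m68; apply: HQ.
  exists (nt_graph g Y), (nsites g), D2; split=> //=.
  - exact: extends_add.
  - by rewrite /set_at eqxx.
  - by rewrite addn1.
- exact: (@tree_spec_binary 1).
- exact: (@tree_spec_binary 2).
- exact: (@tree_spec_unary 3).
- exact: (@tree_spec_unary 4).
- exact: (@tree_spec_binary 5).
Qed.

Definition production_prog : prog := (
  61 <~ $61 - #1;; 62 <~ @[$60];; nt_addr_prog;; 68 <~ $64;;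
  63 <~ @[$60 + #1];; 60 <~ $60 + #2;; tree_loop;;
  67 <~ #6;; 72 <~ $71;; 73 <~ $71;; 66 <~ $68;; connect_prog 71)%P.

Definition grammar_prog : prog := (While ($61) production_prog)%P.

Definition tree_total (l : seq (Nt * ltl (S + Nt))) : nat :=
  \sum_(r <- l) ltl_size r.2.

Lemma run_production Y t don l g D s : parse_inv g [::] don D s ->
  don ++ (Y, t) :: l = productions G ->
  holds_at M0 (reg s 60) (encode_production (Y, t)) ->
  reg s 60 + 2 + 2 * ltl_size t <= base ->
  run production_prog s (2000 * X ^ 3 * (ltl_size t).+1) (fun s' => exists g' D',
    [/\ parse_inv g' [::] (rcons don (Y, t)) D' s', nsites g' = nsites g + ltl_size t,
        reg s' 60 = reg s 60 + 2 + 2 * ltl_size t & reg s' 61 = reg s 61 - 1]).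
Proof.
move=> inv dl; rewrite /encode_production /= 2!holds_at_cons => -[e1 [e2 h]] le.
have X0 := X_gt0.
have [inv' e70 _ gi] := inv; have inp := h_input (i_header inv').
apply: run_le.
  do 2 (apply: run_seq; apply: run_setreg => /=); upd; rewrite inp ?e1; last lia.
  apply: run_seq; apply: (run_imp (run_nt_addr _)); first by case: (i_globals inv').
  rewrite /= => s1 [e64 m1 fr1].
  do 3 (apply: run_seq; apply: run_setreg => /=); upd; rewrite m1 !(fr1 60) //= inp ?e2; last lia.
  apply: run_seq; apply: run_le.
    apply: (@run_tree t g [::] don D _ 0).
    - apply: parse_inv_regs inv _ _ _ _; rewrite /= ?m1 ?(fr1 70) ?(fr1 71) // => r Hr.
      do 3 (rewrite ifF; last lia); rewrite fr1; [|lia|lia].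
      by do 2 (rewrite ifF; last lia).
    - by rewrite /= addn0.
    - by rewrite /= addnC /= addnC -addnA addnA in h *; move: h; rewrite -addnA.
    - by rewrite /=.
    move=> s2 [g2 [r [D2 [inv2 ext2 l2 n2 [k63 k60 k61 k68]]]]].
    (* With [n = 0] the continuation is just the exit from the loop, followed by the rule from the
       root of the right-hand side to its nonterminal. *)
    apply: run_while_done => //.
    do 4 (apply: run_seq; apply: run_setreg => /=); upd.
    have [sinv2 e70' [e71 _] gi2] := inv2.
    apply: (@run_connect _ _ r 6 r r (nt_site Y)) => //=; first by rewrite k68 /= e64.
    exists (set_up g2 r 6 r r (nt_site Y)), D2; split=> //=.
    - split=> //=.
      + apply: sat_inv_regs (sat_inv_connect r 6 r r (nt_site Y) sinv2) _ _ => //= q Hq.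
        by rewrite !ifF //; lia.
      + apply: graph_inv_prod gi2 l2 _.
        by rewrite -dl; apply: List.in_or_app; right; left.
    - by rewrite k61 /= fr1.
  exact: leqnn.
rewrite /= -/X; have : 0 < X ^ 3 by rewrite expn_gt0 X0.
rewrite 2!expnS expn1; nia.
Qed.

Lemma run_grammar g D s : parse_inv g [::] [::] D s ->
  reg s 61 = size (productions G) ->
  holds_at M0 (reg s 60) (flatten [seq encode_production r | r <- productions G]) ->
  reg s 60 + size (flatten [seq encode_production r | r <- productions G]) <= base ->
  run grammar_prog s
    (3000 * X ^ 3 * \sum_(r <- productions G) (ltl_size r.2).+1 + 2)
    (fun s' => exists g' D',
      parse_inv g' [::] (productions G) D' s' /\
      nsites g' = nsites g + tree_total (productions G)).
Proof.
move=> inv e61 h le; have X3 : 0 < X ^ 3 by rewrite expn_gt0 X_gt0.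
apply: run_le.
  apply: (run_while_seq (l := productions G) (B := fun r => 2000 * X ^ 3 * (ltl_size r.2).+1)
    (I := fun l s' => exists g' don D', [/\ parse_inv g' [::] don D' s',
      don ++ l = productions G, reg s' 61 = size l, nsites g' = nsites g + tree_total don &
      holds_at M0 (reg s' 60) (flatten [seq encode_production r | r <- l]) /\
      reg s' 60 + size (flatten [seq encode_production r | r <- l]) <= base])).
  - by exists g, [::], D; rewrite /tree_total big_nil addn0.
  - move=> s1 [g1 [don [D1 [inv1 dl f61 n1 _]]]]; split; first by rewrite /= f61.
    by exists g1, D1; rewrite -dl cats0.
  move=> [Y t] l s1 [g1 [don [D1 [inv1 dl f61 n1 [h1 le1]]]]].
  rewrite /= f61; split=> //.
  rewrite [flatten _]/= -cat_cons -cat_cons -/(encode_production (Y, t)) in h1 le1.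
  rewrite size_cat encode_production_size in le1.
  case/holds_at_cat: h1 => h1 h2; rewrite encode_production_size in h2.
  apply: (run_imp (run_production inv1 dl h1 _)); first by move: le1 => /=; lia.
  move=> s2 [g2 [D2 [inv2 n2 f60 f61']]].
  exists g2, (rcons don (Y, t)), D2; split=> //.
  - by rewrite cat_rcons.
  - by rewrite f61' f61 subn1.
  - by rewrite n2 n1 /tree_total -cats1 big_cat big_seq1 addnA.
  by rewrite f60; split; [rewrite -addnA | move: le1 => /=; lia].
rewrite /= leq_add2r big_distrr /=.
apply: leq_sum => r _; nia.
Qed.

(** * Vectors and the LTL semantics *)

Lemma until_bitP fuel v1 v2 (pos : nat -> nat) i :
  (forall i, next_pos J (pos i) = pos i.+1) ->
  reflect (exists2 d, d < fuel & bit v2 (pos (i + d)) /\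
      forall d', d' < d -> bit v1 (pos (i + d')))
    (until_bit J fuel v1 v2 (pos i)).
Proof.
move=> Hpos; elim: fuel i => [|fuel IH] i /=; first by constructor; case.
rewrite Hpos; apply: (iffP orP) => [[b2|/andP[b1 /IH[d df [b2 H]]]]|[d df [b2 H]]].
- by exists 0; rewrite ?addn0.
- exists d.+1 => //; split=> [|[|d'] Hd']; rewrite ?addn0 ?addnS -?addSn //.
  exact: H.
case: d => [|d] in df b2 H *; first by left; rewrite -(addn0 i).
right; apply/andP; split; first by rewrite -(addn0 i) H.
apply/IH; exists d => //; split=> [|d' Hd']; rewrite addSn -addnS //.
exact: H.
Qed.

Section LassoSemantics.
Variables (l : lasso S) (b : nat).
Hypothesis holds_l : holds_at M0 b (encode_lasso l).
Hypothesis jumps_l : lasso_jumps J b l.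
Hypothesis l_E : b + code_size l <= E.

Let su := size (stem l).
Let sv := size (loop l).

Definition position (i : nat) : nat :=
  if i < su then b + 1 + i else b + su + 2 + (i - su) %% sv.

Let sv_gt0 : 0 < sv. Proof. exact: loop_size. Qed.

Let code_E : b + su + sv + 2 <= E.
Proof. by move: l_E; rewrite /code_size /lasso_size -/su -/sv; lia. Qed.

Let next_pos_eq k : b <= k < b + su + sv + 2 -> next_pos J k =
  if (k == b + su) || (k == b + su + 1 + sv) then b + su + 2 else k.+1.
Proof.
move=> Hk; rewrite /next_pos jumps_l; last first.
  by rewrite /code_size /lasso_size -/su -/sv; lia.
rewrite -/su -/sv /jump_start -/su; case: ((k == _) || _) => //.
by rewrite addn2.
Qed.

Lemma position_lt i : position i < E.
Proof.
have := code_E; have := ltn_pmod (i - su) sv_gt0; rewrite /position.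
by case: (ltnP i su); lia.
Qed.

Lemma next_position i : next_pos J (position i) = position i.+1.
Proof.
have := ltn_pmod (i - su) sv_gt0; rewrite /position.
case: (ltnP i su) => Hi Hm.
  rewrite next_pos_eq; last lia.
  case: (ltnP i.+1 su) => H1.
    by rewrite (_ : (_ || _) = false); lia.
  rewrite (_ : (_ || _) = true); last lia.
  by rewrite (_ : i.+1 - su = 0) ?mod0n; lia.
rewrite (ltnNge i.+1) (leqW Hi) /= subSn //.
set r := (i - su) %% sv in Hm *.
have -> : (i - su).+1 %% sv = if r.+1 == sv then 0 else r.+1.
  rewrite -addn1 -modnDml -/r addn1; case: eqP => [->|ne]; first by rewrite modnn.
  by rewrite modn_small; lia.
rewrite next_pos_eq; last lia.
case: (r.+1 =P sv) => H1; first by rewrite (_ : (_ || _) = true); lia.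
by rewrite (_ : (_ || _) = false) /=; lia.
Qed.

(* The cell of the length of the stem acts as a position before the first one. *)
Lemma first_position : next_pos J b = position 0.
Proof.
have v0 := sv_gt0; rewrite /position next_pos_eq; last lia.
rewrite sub0n mod0n; case: (ltnP 0 su) => H.
  by rewrite (_ : (_ || _) = false) /=; lia.
by rewrite (_ : (_ || _) = true) /=; lia.
Qed.

Lemma letter_position i : M0 (position i) = enum_rank (lasso_word l i).
Proof.
have [_ _ H] := encode_lasso_holds holds_l.
(* [periodic_word] takes the first letter of the loop as the default of [nth], and [x] is that
   letter. *)
have [x Hx] : exists x, forall i, lasso_word l i =
  if i < su then nth x (stem l) i else nth x (loop l) ((i - su) %% sv).
  rewrite /su /sv /lasso_word /stem /loop; clear.
  case: l => -[u [|y v]] //= Hv.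
  by exists y.
have [Hu Hv] := H x.
rewrite Hx /position; case: (ltnP i su) => Hi; first by rewrite Hu.
by rewrite Hv // ltn_pmod.
Qed.

Lemma position_periodic i : su <= i -> position (i + sv) = position i.
Proof.
move=> Hi; rewrite /position !ifF; try lia.
by rewrite (_ : i + sv - su = sv + (i - su)) ?modnDl; last lia.
Qed.

Lemma sat_bit phi i :
  sat (lasso_word l) i phi <-> bit (vector_of phi) (position i).
Proof.
elim: phi i => [a|p IHp q IHq|p IHp q IHq|p IHp|p IHp|p IHp q IHq] i /=;
  rewrite bit_op_vector ?position_lt //=.
- rewrite letter_position; split=> [->//|/eqP/ord_inj/enum_rank_inj //].
- by rewrite IHp IHq; split=> [[-> ->]|/andP[]].
- by rewrite IHp IHq; split=> [[->|->]|/orP]; rewrite ?orbT.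
- by rewrite IHp; split=> /negP.
- by rewrite IHp next_position.
have U := until_bitP E (vector_of p) (vector_of q) i next_position.
split=> [[j [ij /IHq qj Hp]]|/U[d _ [qd Hp]]].
  apply/U.
  have ex : exists d, bit (vector_of q) (position (i + d)) by exists (j - i); rewrite subnKC.
  case: (ex_minnP ex) => d qd dmin; exists d; last first.
    split=> // d' d'd; apply/IHp; apply: Hp.
    have : d <= j - i by apply: dmin; rewrite subnKC.
    lia.
  (* Fuel [E] suffices: [E] exceeds [su + sv], so a least witness at distance [d >= E] lies more
     than a period beyond the stem, and moving it back by [sv] gives a smaller one. *)
  rewrite ltnNge; apply/negP => Ed; have v0 := sv_gt0; have cE := code_E.
  have /dmin : bit (vector_of q) (position (i + (d - sv))).
    by rewrite -position_periodic; [rewrite (_ : i + (d - sv) + sv = i + d) //|]; lia.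
  lia.
exists (i + d); split; [exact: leq_addr | exact/IHq|].
move=> k /andP[ik kd]; apply/IHp; rewrite -(subnKC ik); apply: Hp; lia.
Qed.

Lemma models_bit phi : models l phi <-> bit (vector_of phi) (next_pos J b).
Proof. by rewrite first_position; apply: sat_bit. Qed.
End LassoSemantics.

Fixpoint check (v b : nat) (ls : seq (lasso S)) (np : nat) : bool :=
  if ls is l :: ls' then
    (bit v (next_pos J b) == (0 < np)) && check v (b + code_size l) ls' np.-1
  else true.

(** Whether a formula separates depends on its vector alone; this is why one stored formula per slot
    can represent all formulas with that vector. *)
Lemma checkP phi b P N : lassos_at M0 J b (P ++ N) ->
  b + total_size (P ++ N) <= E ->
  reflect (separates P N phi) (check (vector_of phi) b (P ++ N) (size P)).
Proof.
(* After the positive lassos the counter is 0 and stays there, as [0.-1] is 0; the rest of the check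
   concerns negative lassos only. *)
have sep0 ls b' : lassos_at M0 J b' ls -> b' + total_size ls <= E ->
  reflect (forall l, l \in ls -> ~ models l phi) (check (vector_of phi) b' ls 0).
  elim: ls b' => [|l ls IH] b' /=; first by constructor.
  case=> h j at_ls; rewrite /total_size big_cons => le.
  have le' : b' + code_size l <= E by lia.
  have m := models_bit h j le' phi.
  apply: (iffP andP) => [[/eqP bf /IH H] l'|H].
    rewrite inE => /predU1P[->|]; first by move=> /m; rewrite bf.
    by apply: H => //; rewrite /total_size; lia.
  split; first by apply/eqP/negbTE/negP => /m; apply: H; rewrite mem_head.
  apply/IH => //; first by rewrite /total_size; lia.
  by move=> l' l'in; apply: H; rewrite inE l'in orbT.
elim: P b => [|l P IH] b /= at_ls le.
  by apply: (iffP (sep0 _ _ at_ls le)) => [H|[_ H]].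
case: at_ls => h j at_ls; move: le; rewrite /total_size big_cons => le.
have le' : b + code_size l <= E by lia.
have m := models_bit h j le' phi.
apply: (iffP andP) => [[/eqP bt /IH H]|[HP HN]].
  have [//||HP HN] := H; first by rewrite /total_size; lia.
  split=> // l'; rewrite inE => /predU1P[->|]; last exact: HP.
  by apply/m; rewrite bt.
split; first by apply/eqP; apply/m; apply: HP; rewrite mem_head.
apply/IH => //; first by rewrite /total_size; lia.
by split=> // l' l'in; apply: HP; rewrite inE l'in orbT.
Qed.

(** * Selecting a separating vector *)

(** The first [#|Nt|] sites are the nonterminals themselves in the order of their ranks; [start G]
    is only the default of [nth]. *)
Definition initial_graph : graph :=
  Graph #|Nt| (fun i => Atom (inr (nth (start G) (enum Nt) i)))
    (fun _ => None) (fun _ => None).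

Lemma initial_graph_inv : graph_inv initial_graph [::] [::] [::].
Proof.
split=> //.
- by move=> Y; split; [exact: ltn_ord | rewrite /= /nt_site nth_enum_rank].
move=> i Hi; rewrite /site_done /=.
have -> : nth (start G) (enum Nt) i = enum_val (Ordinal Hi : 'I_#|Nt|).
  by rewrite (enum_val_nth (start G)).
by rewrite /nt_site enum_valK; apply: rt_refl.
Qed.

(** Memory that is still 0 already reads as empty slots, absent rules and null links, so apart from
    the jump table nothing has to be initialized. *)
Lemma initial_sat_inv s : globals E base s -> reg s 80 = 0 ->
  (forall a, a < base -> memory s a = M0 a) ->
  (forall k, k < E -> memory s (cell 0 k + 6) = J k) ->
  (forall i v f, v < X -> f < 16 -> f != 6 -> memory s (cell i v + f) = 0) ->
  sat_inv initial_graph [::] [::] s.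
Proof.
move=> gl e80 m1 m2 m3; have X0 := X_gt0; split=> //.
  by split=> //= i; rewrite m3.
by split=> // i v vX; rewrite m3.
Qed.

(** The induction on derivations speaks of all sites with the given label, because a nonterminal has
    many. Through a production, a vector passes from the root of the right-hand side to the
    nonterminal's own site and from there along the chain. *)
Lemma saturated_complete g don D0 D M : graph_inv g [::] don D0 ->
  (forall r, List.In r (productions G) -> List.In r don) ->
  {subset D0 <= D} -> closed_in g D D -> slots_ok g D M ->
  forall t phi, derives G t phi -> forall i, i < nsites g -> label g i = t ->
  (i, vector_of phi) \in D.
Proof.
move=> gi all sub [c1 c2] sl.
have doneD i : i < nsites g -> site_done g D i.
  move=> Hi; apply: site_done_mono (w_site gi Hi) => //.
    by move=> j [[[op i1] i2] it] u; split=> //; apply: (w_bound gi u).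
  by move=> j k; apply: rt_step.
have up_lt i x : up g i = Some x -> i < nsites g.
  by case: x => [[[op i1] i2] it] /(w_bound gi).
have rule op t1 t2 p q i : has_rule g op t1 t2 i ->
    (forall j, j < nsites g -> label g j = t1 -> (j, vector_of p) \in D) ->
    (forall j, j < nsites g -> label g j = t2 -> (j, vector_of q) \in D) ->
    (i, op_vec op (vector_of p) (vector_of q)) \in D.
  move=> [i1 [i2 [l1 l2 u1 u2]]] H1 H2.
  have := H1 _ (up_lt _ _ u1) l1; have := H2 _ (up_lt _ _ u2) l2 => in2 in1.
  exact: c1 u1 u2 in1 in2.
move=> t phi; elim=> {t phi} [a|Y t phi Yt _ IH|t1 t2 p q _ IH1 _ IH2|t1 t2 p q _ IH1 _ IH2|
    t p _ IH|t p _ IH|t1 t2 p q _ IH1 _ IH2] i Hi Ei; have := doneD i Hi;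
  rewrite /site_done Ei => Hdone.
- by [].
- have [r [rN lr ur]] := w_prod gi (all _ Yt).
  have in_r := IH r rN lr.
  have in_Y : (nt_site Y, vector_of phi) \in D.
    by rewrite -(op_vector_copy M0 J (vector_of phi) (vector_of_lt phi)); exact: (c1 _ _ _ _ _ _ ur ur).
  elim: Hdone in_Y {Ei Hi} => [j k|//|j k k' _ IHj _ IHk] Hj; first by move=> Hin; apply: c2 Hin.
  exact: IHk (IHj Hj).
- exact: (rule _ _ _ _ _ _ Hdone IH1 IH2).
- exact: (rule _ _ _ _ _ _ Hdone IH1 IH2).
- exact: (rule _ _ _ p p _ Hdone IH IH).
- exact: (rule _ _ _ p p _ Hdone IH IH).
- exact: (rule _ _ _ _ _ _ Hdone IH1 IH2).
Qed.

Definition check_prog : prog := (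
  1 <~ $77;; 2 <~ $70;; next_prog 2;; bit_prog;;
  If ($79)
    (79 <~ $79 - #1;; If ($3) Skip (78 <~ #0))
    (If ($3) (78 <~ #0) Skip))%P.

Definition select_prog : prog := (
  59 <~ #0;; 62 <~ @[#2];; nt_addr_prog;; 76 <~ $64;; 77 <~ #0;;
  While ($91 - $77) (
    If @[$76 + #3]
      (78 <~ #1;; 79 <~ @[#3];; traverse check_prog;; If ($78) (59 <~ $76) Skip)
      Skip;;
    77 <~ $77 + #1;; 76 <~ $76 + #16);;
  0 <~ $59)%P.

Section Selection.
Variables (P N : seq (lasso S)).
Hypothesis lassos_ok : lassos_at M0 J 6 (P ++ N).
Hypothesis lassos_in : holds_at M0 6 (encode_lassos (P ++ N)).
Hypothesis E_eq : 6 + total_size (P ++ N) = E.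
Hypothesis M0_P : M0 3 = size P.
Hypothesis M0_N : M0 4 = size N.

Let chk v := check v 6 (P ++ N) (size P).

Lemma size_lassos_le : size (P ++ N) <= E.
Proof.
rewrite -E_eq -sum1_size /total_size; apply: leq_trans (leq_addl _ _).
by apply: leq_sum => l _; rewrite /code_size addn2.
Qed.

Lemma run_check g s v : header_ok g (memory s) -> globals E base s ->
  reg s 77 = v -> v < X -> reg s 78 = 1 -> reg s 79 = size P ->
  run (traverse check_prog) s (400 * X ^ 2) (fun s' =>
    [/\ memory s' = memory s, reg s' 78 = chk v &
        forall r, 6 <= r -> r \notin [:: 70; 71; 72; 78; 79] ->
          reg s' r = reg s r]).
Proof.
move=> hd gl e77 vX e78 e79; have X0 := X_gt0; have EX := E_lt_X.
pose same s' := forall r, 6 <= r -> r \notin [:: 70; 71; 72; 78; 79] ->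
  reg s' r = reg s r.
apply: run_le.
  apply: (run_imp (@run_traverse S E M0 check_prog (100 * X + 200)
    (fun b ls s' => [/\ memory s' = memory s, same s' & exists (ok : bool) np,
      [/\ reg s' 78 = ok, reg s' 79 = np & chk v = ok && check v b ls np]])
    (P ++ N) s _ _ _ _ lassos_in _ _)).
  - move=> b ls s1 s2 [m1 sm [ok [np [h1 h2 h3]]]] m2 r2; split; first by rewrite m2.
      move=> r Hr Hr'; rewrite r2 ?sm //; move: Hr'; apply: contraNN.
      by rewrite !inE => /or3P[] ->; rewrite ?orbT.
    by exists ok, np; rewrite !r2.
  - by move=> b ls s1 [m1 _ _] a aE; rewrite m1 (h_input hd) //; lia.
  - move=> b l ls s1 [m1 sm [ok [np [h1 h2 h3]]]] e70 hl le.
    have bE : b < E by move: le; rewrite /code_size; lia.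
    have gl1 : globals E base s1 by case: gl => g1 g2 g3; split; rewrite sm.
    apply: run_le.
      do 2 (apply: run_seq; apply: run_setreg => /=); upd.
      apply: run_seq; apply: (run_imp (run_next (base := base) (J := J) (E := E) (M0 := M0) _ _ _));
        rewrite /= ?e70 //; first by rewrite m1; apply: header_lasso hd.
      move=> s2 [f2 m2 fr2].
      apply: run_seq; apply: (run_imp (run_bit (E := E) _ _)).
      - by rewrite f2; apply: next_pos_le.
      - by rewrite fr2 //= sm // e77.
      rewrite f2 [reg s2 1]fr2 //= sm // e77 => s3 [f3 m3 _ _ fr3].
      have r3 r : 6 <= r -> reg s3 r = reg s1 r.
        by move=> Hr; rewrite fr3 // fr2 /=; [rewrite !ifF //; lia | lia].
      have m3' : memory s3 = memory s by rewrite m3 m2.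
      have sm3 : same s3 by move=> r Hr Hr'; rewrite r3 ?sm.
      rewrite [check _ _ _ _]/= in h3; move: (bit v _) f3 h3 => bt f3 h3.
      (* What each of the four outcomes of the two tests has to establish. *)
      have fin s4 (np' : nat) (ok' : bool) : memory s4 = memory s ->
         (forall r, r != 78 -> r != 79 -> reg s4 r = reg s3 r) ->
         reg s4 78 = ok' -> reg s4 79 = np' -> np' = np.-1 -> ok' = ok && (bt == (0 < np)) ->
         [/\ [/\ memory s4 = memory s, same s4 & exists (ok : bool) np,
      [/\ reg s4 78 = ok, reg s4 79 = np & chk v = ok && check v (b + code_size l) ls np]],
          reg s4 70 = b & reg s4 71 = reg s1 71].
        move=> m4 fr4 k1 k2 e1 e2; split; [split=> //|by rewrite fr4 ?r3|by rewrite fr4 ?r3].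
          move=> r Hr Hr'; rewrite fr4 ?sm3 //; move: Hr'; apply: contraNneq => ->;
          by rewrite !inE ?eqxx ?orbT.
        by exists ok', np'; split=> //; rewrite e1 e2 -andbA.
      apply: run_if; rewrite /= r3 // h2 => Hnp.
        apply: run_seq; apply: run_setreg => /=; upd; rewrite r3 // h2.
        apply: run_if; rewrite /= f3 => Hbt.
          apply: run_skip; apply: (fin _ (np - 1) ok) => //=; try lia.
          - by move=> r n1 n2; rewrite (negbTE n2).
          - by rewrite r3.
        apply: run_setreg; apply: (fin _ (np - 1) false); rewrite /update //=; try lia.
        - by move=> r n1 n2; rewrite (negbTE n1) (negbTE n2).
      apply: run_if; rewrite /= f3 => Hbt.
        apply: run_setreg; apply: (fin _ 0 false); rewrite /update //=; try lia.
        - by move=> r n1 n2; rewrite (negbTE n1).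
        - by rewrite r3 // h2.
      apply: run_skip; apply: (fin _ 0 ok) => //=; try lia.
      - by rewrite r3.
      - by rewrite r3 // h2.
    rewrite /= -/X; nia.
  - by rewrite M0_P M0_N size_cat.
  - by rewrite E_eq.
  - by split=> //; exists true, (size P).
  move=> s1 [_ [m1 sm [ok [np [h1 _ h3]]]]]; split=> //.
  by rewrite h1 h3 andbT.
have := size_lassos_le; rewrite expnS expn1 => sz; nia.
Qed.

Lemma run_select g D s : sat_inv g D [::] s -> M0 2 = nt_site (start G) ->
  run select_prog s (700 * X ^ 3) (fun s' => memory s' = memory s /\
    ((reg s' 0 = 0 /\ forall v, v < X -> (nt_site (start G), v) \in D -> ~~ chk v) \/
     exists v, [/\ v < X, (nt_site (start G), v) \in D, chk v &
       reg s' 0 = cell (nt_site (start G)) v])).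
Proof.
set st := nt_site _ => inv e2; have X0 := X_gt0; have EX := E_lt_X.
have [gl hd sl _ _] := inv; have [g90 g91 g92] := gl.
have E6 : 6 <= E by rewrite -E_eq leq_addr.
have inp a : a < E -> memory s a = M0 a by move=> aE; rewrite (h_input hd) //; lia.
apply: run_le.
  do 2 (apply: run_seq; apply: run_setreg => /=); upd; rewrite inp ?e2; last lia.
  apply: run_seq; apply: (run_imp (run_nt_addr _)) => //=.
  move=> s1 [e64 m1 fr1].
  do 2 (apply: run_seq; apply: run_setreg => /=); upd; rewrite e64.
  apply: run_seq; apply: (run_imp (P := fun s' => memory s' = memory s /\
    ((reg s' 59 = 0 /\ forall v, v < X -> (st, v) \in D -> ~~ chk v) \/
     exists v, [/\ v < X, (st, v) \in D, chk v & reg s' 59 = cell st v]))).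
    apply: (run_while (n := X) (I := fun j s' => exists v,
      [/\ [/\ j = X - v, v <= X, reg s' 76 = cell st v, reg s' 77 = v & memory s' = memory s],
       globals E base s' &
       ((reg s' 59 = 0 /\ forall v', v' < v -> (st, v') \in D -> ~~ chk v') \/
       exists v, [/\ v < X, (st, v) \in D, chk v & reg s' 59 = cell st v])])).
    - exists 0; rewrite subn0; split=> //=.
        by split; rewrite /= fr1.
      by left; rewrite fr1.
    - move=> j s2 [v [[jE vX e76 e77 m2] [_ k91 _] H]] /=; rewrite k91 e77 -/X => vX'.
      split=> //; case: H => [[h0 H]|H]; last by right.
      by left; split=> // v' Hv'; apply: H; lia.
    move=> j s2 [v [[jE vX e76 e77 m2] [k90 k91 k92] H]] /=; rewrite k91 e77 -/X => vX'.
    split; first lia.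
    have {}vX' : v < X by lia.
    apply: run_seq; apply: (run_imp (P := fun s' => [/\ memory s' = memory s,
       [/\ reg s' 76 = cell st v, reg s' 77 = v, reg s' 90 = E, reg s' 91 = X & reg s' 92 = base] &
       ((reg s' 59 = 0 /\ forall v', v' < v.+1 -> (st, v') \in D -> ~~ chk v') \/
       exists v, [/\ v < X, (st, v) \in D, chk v & reg s' 59 = cell st v])])).
      (* Shared by the two cases in which [v] is rejected: its slot is empty, or its check fails. *)
      have next (no : (st, v) \in D -> ~~ chk v) q : q = reg s2 59 ->
        (q = 0 /\ (forall v', v' < v.+1 -> (st, v') \in D -> ~~ chk v')) \/
         (exists v, [/\ v < X, (st, v) \in D, chk v & q = cell st v]).
        move=> ->; case: H => [[h0 H]|H]; last by right.
        left; split=> // v'; rewrite ltnS leq_eqVlt => /predU1P[-> //|]; exact: H.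
      apply: run_if; rewrite /= e76 m2 => Hp; last first.
        apply: run_skip; split=> //; apply: next => //.
        by rewrite -(s_present sl) // Hp.
      rewrite (s_present sl) // in Hp.
      do 2 (apply: run_seq; apply: run_setreg => /=); upd.
      rewrite m2 inp ?M0_P; last lia.
      apply: run_seq; apply: (run_imp (@run_check g _ v _ _ _ _ _ _)) => //=.
      move=> s3 [m3 e78 fr3].
      have same3 : [/\ reg s3 76 = cell st v, reg s3 77 = v, reg s3 90 = E, reg s3 91 = X & reg s3 92 = base].
        by rewrite !fr3.
      apply: run_if; rewrite /= e78 => Hc.
        have [f76 f77 f90 f91 f92] := same3.
        apply: run_setreg; upd; split=> //; right; exists v; split=> //.
        by case: chk Hc.
      apply: run_skip; split=> //; apply: next; last by rewrite fr3.
      by move=> _; case: chk Hc.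
    move=> s3 [m3 [f76 f77 f90 f91 f92] H3].
    apply: run_seq; apply: run_setreg; apply: run_setreg; upd.
    exists v.+1; split; last exact: H3.
    - by rewrite f76 f77 addn1; split=> //; [lia | rewrite /cell; lia].
    - by split.
  move=> s2 [m2 H]; apply: run_setreg; upd; split=> //.
rewrite /= -/X !expnS !expn0 !muln1; nia.
Qed.

Definition core_prog : prog := (
  62 <~ @[#1];; nt_addr_prog;; 70 <~ $64;; 60 <~ $90;; 61 <~ @[#5];;
  grammar_prog;; saturate_prog;; select_prog)%P.

Lemma run_core s : globals E base s -> reg s 80 = 0 ->
  (forall a, a < base -> memory s a = M0 a) ->
  (forall k, k < E -> memory s (cell 0 k + 6) = J k) ->
  (forall i v f, v < X -> f < 16 -> f != 6 -> memory s (cell i v + f) = 0) ->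
  M0 1 = #|Nt| -> M0 2 = nt_site (start G) -> M0 5 = size (productions G) ->
  holds_at M0 E (flatten [seq encode_production r | r <- productions G]) ->
  E + size (flatten [seq encode_production r | r <- productions G]) <= base ->
  run core_prog s ((5000 + 5000) * X ^ 6 * grammar_size G) (fun s' => exists answer,
    returns s' answer /\ correct_answer P N G answer).
Proof.
move=> gl e80 m1 m2 m3 M1 M2 M5 hp le; have X0 := X_gt0; have EX := E_lt_X.
have inv0 := initial_sat_inv gl e80 m1 m2 m3; have [g90 _ _] := gl.
have E6 : 6 <= E by rewrite -E_eq leq_addr.
apply: run_le.
  apply: run_seq; apply: run_setreg => /=; upd; rewrite m1 ?M1; last lia.
  apply: run_seq; apply: (run_imp (run_nt_addr _)) => //=.
  move=> s1 [e64 mem1 fr1].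
  do 3 (apply: run_seq; apply: run_setreg => /=); upd.
  rewrite e64 (fr1 90) //= g90 mem1 m1 ?M5; last lia.
  apply: run_seq; apply: (run_imp (run_grammar (g := initial_graph) (D := [::]) _ _ _ _)) => //=.
    split=> //; last exact: initial_graph_inv.
    apply: sat_inv_regs inv0 _ _ => //= r Hr; do 3 (rewrite ifF; last lia).
    rewrite fr1; [|lia|lia]; by rewrite ifF //; lia.
  move=> s2 [g [D0 [[inv2 _ _ gi] ns]]].
  (* After parsing every filled slot is still pending, hence the trivial permutation. *)
  have := run_saturate inv2 (perm_refl _) (w_ok gi); rewrite ns => sat.
  apply: run_seq; apply: (run_imp sat).
  move=> s3 [D [inv3 cl sub _]].
  apply: (run_imp (run_select inv3 M2)) => s4 [mem4 H].
  have [stN stl] := w_nt gi (start G).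
  have sl := i_slots inv3.
  have le6 : 6 + total_size (P ++ N) <= E by rewrite E_eq.
  (* A separating formula in the language would put its vector at the start site by completeness,
     and that vector would pass the check. Conversely, soundness provides a derived formula for an
     accepted vector. *)
  case: H => [[r0 no]|[v [vX inD ck r0]]].
    exists None; split=> // phi /langP der /(checkP phi lassos_ok le6).
    apply/negP; apply: no; first exact: vector_of_lt.
    exact: (saturated_complete gi _ sub cl sl der).
  have [phi [sh der vec]] := s_sound sl inD.
  exists (Some phi); split; last first.
    split; first by apply/langP; rewrite -stl.
    by apply/(checkP phi lassos_ok le6); rewrite vec.
  by split; rewrite r0; [exact: cell_gt0 | rewrite mem4; exact: shared_stored sh].
(* The sites number [#|Nt|] plus the nodes of all right-hand sides, which is at most
   [grammar_size G]; saturation dominates the other phases. *)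
rewrite /= /grammar_size /tree_total -/X.
set s1 := \sum_(r <- _) ltl_size _; set s2 := \sum_(r <- _) _.+1.
have s12 : s1 <= s2 by apply: leq_sum => r _.
have a0 : 0 < #|Nt| by apply/card_gt0P; exists (start G).
have X3 : X ^ 1 <= X ^ 3 by rewrite leq_pexp2l.
have X6 : X ^ 3 <= X ^ 6 by rewrite leq_pexp2l.
rewrite expn1 in X3; move: (X ^ 3) (X ^ 6) #|Nt| X3 X6 a0 => y Y a X3 X6 a0.
have l1 : y * s2 <= Y * s2 by rewrite leq_mul2r X6 orbT.
have l2 : Y * s1 <= Y * s2 by rewrite leq_mul2l s12 orbT.
have l3 : Y <= Y * a by rewrite leq_pmulr.
lia.
Qed.
End Selection.
End Saturation.

(** * The complete program *)

Definition jump_prog : prog := (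
  73 <~ $70 + @[$70];; 74 <~ $73 + #2;;
  ($92 + times16 ($73)) + #6 ::= $74;;
  75 <~ ($73 + #1) + @[$73 + #1];;
  ($92 + times16 ($75)) + #6 ::= $74)%P.

(** The lassos are traversed twice because the jump table lies above the whole input: [base] is
    known only after the lassos and the productions have been skipped. *)
Definition setup_prog : prog := (
  traverse Skip;; 90 <~ $70;; 60 <~ $90;; 61 <~ @[#5];;
  While ($61) (60 <~ ($60 + #2) + (@[$60 + #1] + @[$60 + #1]);; 61 <~ $61 - #1);;
  92 <~ $60;; 91 <~ #1;; 62 <~ $90;;
  While ($62) (91 <~ $91 + $91;; 62 <~ $62 - #1);;
  traverse jump_prog)%P.

Section Setup.
Variables (S Nt : finType) (G : grammar S Nt) (P N : seq (lasso S)).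

Let ls := P ++ N.
Let input := encode_instance P N G.
Let M0 : nat -> nat := fun i => nth 0 input i.
Let E := 6 + total_size ls.
Let prods := flatten [seq encode_production r | r <- productions G].
Let base := E + size prods.
Let J := jumps 6 ls (fun _ => 0).

Lemma input_parts :
  [/\ [/\ M0 1 = #|Nt|, M0 2 = nt_site (start G), M0 3 = size P, M0 4 = size N &
       M0 5 = size (productions G)],
      holds_at M0 6 (encode_lassos ls), holds_at M0 E prods & size input = base].
Proof.
have inputE : input = [:: #|S|; #|Nt|; nat_of_ord (enum_rank (start G));
      size P; size N; size (productions G)] ++ (encode_lassos ls ++ prods).
  by rewrite /input /encode_instance /encode_lassos map_cat flatten_cat -!catA.
have : holds_at M0 0 input by [].
rewrite inputE => /holds_at_cat[_ /holds_at_cat[h1 h2]].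
rewrite size_encode_lassos in h2; split=> //.
by rewrite !size_cat size_encode_lassos /base /E addnA.
Qed.

Let m34 : M0 3 + M0 4 = size ls.
Proof. by have [[_ _ -> -> _] _ _ _] := input_parts; rewrite size_cat. Qed.

Lemma size_le_E : size ls <= E.
Proof.
rewrite -sum1_size /E /total_size; apply: leq_trans (leq_addl _ _).
by apply: leq_sum => l _; rewrite /code_size addn2.
Qed.

Lemma run_skip_lassos s (Q : state -> Prop) : memory s = M0 ->
  (forall s', memory s' = M0 -> reg s' 70 = E ->
     (forall r, r \notin [:: 70; 71; 72] -> reg s' r = reg s r) -> Q s') ->
  run (traverse Skip) s (41 * E + 40) Q.
Proof.
move=> m HQ; have [_ hl _ _] := input_parts.
apply: run_le.
  apply: run_imp (@run_traverse S E M0 Skip 1 (fun b ls' s' => memory s' = M0 /\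
    forall r, r \notin [:: 70; 71; 72] -> reg s' r = reg s r) ls s _ _ _ m34 hl _ _) _ => //.
  - by move=> b ls' s1 s2 [m1 r1] m2 r2; rewrite m2; split=> // r Hr; rewrite r2 ?r1.
  - by move=> b ls' s1 [-> _].
  - by move=> b l ls' s1 I1 e70 _ _; apply: run_skip.
  by move=> s' [e70 [m1 r1]]; apply: HQ.
have := size_le_E; lia.
Qed.

Lemma run_setup s : memory s = M0 -> (forall r, reg s r = 0) ->
  run setup_prog s (300 * 2 ^ E * (size (productions G)).+1) (fun s' =>
    [/\ globals E base s', reg s' 80 = 0,
        forall a, a < base -> memory s' a = M0 a,
        forall k, k < E -> memory s' (base + 16 * k + 6) = J k &
        forall a, base <= a -> (forall k, k < E -> a != base + 16 * k + 6) -> memory s' a = 0]).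
Proof.
move=> m r0; have [[_ _ _ _ M5] hl hp szi] := input_parts.
have EX : E < 2 ^ E by rewrite ltn_expl.
have M0_out a : base <= a -> M0 a = 0 by move=> Ha; rewrite /M0 nth_default // szi.
have E_base : E <= base by rewrite leq_addr.
apply: run_le.
  apply: run_seq; apply: (run_skip_lassos m) => s1 m1 e70 fr1.
  do 3 (apply: run_seq; apply: run_setreg => /=); upd; rewrite e70 m1 M5.
  apply: run_seq; apply: (run_imp (P := fun s' => [/\ memory s' = M0, reg s' 60 = base,
      reg s' 90 = E & reg s' 80 = 0])).
    apply: (run_while_seq (l := productions G) (B := fun _ => 30) (I := fun l s' =>
     [/\ memory s' = M0, reg s' 61 = size l,
      reg s' 60 + size (flatten [seq encode_production r | r <- l]) = base,
      holds_at M0 (reg s' 60) (flatten [seq encode_production r | r <- l]) &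
      reg s' 90 = E /\ reg s' 80 = 0])).
    - by split=> //=; rewrite fr1 // r0.
    - move=> s2 [m2 e61 e60 _ [e90 e80]] /=; rewrite e61; split=> //.
      by rewrite -e60 addn0.
    move=> r l s2 [m2 e61 e60 h [e90 e80]] /=; rewrite e61; split=> //.
    rewrite [flatten _](_ : _ = encode_production r ++ flatten [seq encode_production r | r <- l]) // in e60 h.
    case/holds_at_cat: h; rewrite encode_production_size => h1 h2.
    rewrite size_cat encode_production_size in e60.
    (* The second cell of a production is its number of nodes, so its code can be skipped without
       parsing it. *)
    have [_ /holds_at_cons[h3 _]] := (holds_at_cons _ _ _ _).1 h1.
    apply: run_le; first (apply: run_seq; apply: run_setreg; apply: run_setreg; upd).
      rewrite m2 h3 e61 subn1 /= (_ : reg s2 60 + 2 + (ltl_size r.2 + ltl_size r.2) = reg s2 60 + (2 + 2 * ltl_size r.2)); last lia.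
      by split=> //; lia.
    by [].
  move=> s2 [m2 e60 e90 e80].
  do 3 (apply: run_seq; apply: run_setreg => /=); upd; rewrite e60 e90.
  apply: run_seq; apply: (run_imp (P := fun s' => [/\ memory s' = M0, globals E base s' & reg s' 80 = 0])).
    apply: (run_while (n := E) (I := fun j s' => [/\ memory s' = M0, reg s' 62 = j, j <= E,
      reg s' 91 = 2 ^ (E - j) & [/\ reg s' 90 = E, reg s' 92 = base & reg s' 80 = 0]])).
    - by rewrite subnn.
    - move=> j s3 [m3 e62 jE e91 [f90 f92 f80]] /= j0; split=> //; split=> //.
      by rewrite e91 -e62 j0 subn0.
    move=> j s3 [m3 e62 jE e91 [f90 f92 f80]] /= j0; split; first lia.
    apply: run_seq; apply: run_setreg; apply: run_setreg; upd; split=> //; try lia.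
    by rewrite e91 (_ : E - j.-1 = (E - j).+1); [rewrite expnS; lia | lia].
  move=> s3 [m3 gl3 e80'].
  apply: run_imp (@run_traverse S E M0 jump_prog 150 (fun b ls' s' => exists f,
    [/\ jumps b ls' f = J, forall a, a < base -> memory s' a = M0 a,
     forall k, k < E -> memory s' (base + 16 * k + 6) = f k,
     forall a, base <= a -> (forall k, k < E -> a != base + 16 * k + 6) -> memory s' a = 0 &
     globals E base s' /\ reg s' 80 = 0]) ls s3 _ _ _ m34 hl _ _) _ => //.
  - move=> b ls' s4 s5 [f [H1 H2 H3 H4 [[k90 k91 k92] k80]]] m5 r5; exists f; rewrite m5.
    by split=> //; split; [split|]; rewrite r5.
  - by move=> b ls' s4 [f [_ H2 _ _ _]] a aE; apply: H2; lia.
  - move=> b l ls' s4 [f [H1 H2 H3 H4 [[k90 k91 k92] k80]]] e70' hl' le.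
    have [hu hv _] := encode_lasso_holds hl'.
    have sz : code_size l = size (stem l) + size (loop l) + 2 by [].
    have rd M q x : (forall a, a < base -> M a = M0 a) -> q < E -> M0 q = x -> M q = x.
      by move=> HM qE <-; apply: HM; lia.
    have wr M q x : q < E -> 
       (forall k, k < E -> update M (base + 16 * q + 6) x (base + 16 * k + 6) =
          update (fun k => M (base + 16 * k + 6)) q x k).
      by move=> qE k kE; rewrite /update; case: eqP => H; case: eqP => H' //; lia.
    pose q1 := b + size (stem l); pose q2 := q1 + 1 + size (loop l).
    have q1E : q1 < E by rewrite /q1; lia.
    have q2E : q2 < E by rewrite /q2 /q1; lia.
    apply: run_le.
      do 2 (apply: run_seq; apply: run_setreg => /=); upd.
      rewrite e70' (rd _ _ _ H2 _ hu); last lia.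
      rewrite -/q1; apply: run_seq; apply: run_setmem => /=.
      rewrite k92 (_ : base + _ + 6 = base + 16 * q1 + 6); last lia.
      set M1 := update _ _ _.
      have M1b a : a < base -> M1 a = M0 a.
        by move=> Ha; rewrite /M1 updN ?H2 //; lia.
      apply: run_seq; apply: run_setreg => /=; upd.
      rewrite (rd M1 (q1 + 1) _ M1b _ hv) -/q2; last by rewrite /q1; lia.
      apply: run_setmem => /=; rewrite k92 (_ : base + _ + 6 = base + 16 * q2 + 6); last lia.
      set M2 := update M1 _ _; split=> //=.
      exists (update (update f q1 (jump_start b l)) q2 (jump_start b l)); split=> //=.
      - by move=> a Ha; rewrite /M2 updN ?M1b //; lia.
      - move=> k kE; rewrite /M2 wr // /update; case: eqP => // _.
        by rewrite /M1 wr // /update; case: eqP => // _; apply: H3.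
      - move=> a Ha Hk; rewrite /M2 updN ?Hk // /M1 updN ?Hk //.
        exact: H4.
    by [].
  - exists (fun _ => 0); split=> //; first by rewrite m3.
    + by move=> k kE; rewrite m3 M0_out //; lia.
    + by move=> a Ha _; rewrite m3 M0_out.
  move=> s4 [_ [f [H1 H2 H3 H4 [H5 H6]]]]; split=> //.
  by move=> k kE; rewrite -H1 H3.
rewrite /= big_const_seq count_predT iter_addn_0.
have := size_le_E; nia.
Qed.
End Setup.

Definition separation_prog : prog := Seq setup_prog core_prog.

Lemma run_separation (S Nt : finType) (G : grammar S Nt) (P N : seq (lasso S)) :
  let E := 6 + total_size (P ++ N) in
  run separation_prog (initial (encode_instance P N G))
    ((5000 + 5000 + 300) * (2 ^ E) ^ 6 * grammar_size G)
    (fun s' => exists answer, returns s' answer /\ correct_answer P N G answer).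
Proof.
move=> E.
have [[M1 M2 M3 M4 M5] hl hp szi] := input_parts G P N.
set M0 := fun i => _ in M1 M2 M3 M4 M5 hl hp.
have X0 : 0 < 2 ^ E by rewrite expn_gt0.
apply: run_le.
  apply: run_seq; apply: (run_imp (run_setup (G := G) (P := P) (N := N) _ _)) => //.
  move=> s1 [gl e80 m1 m2 m3].
  set base := E + size _ in gl m1 m2 m3.
  set J := jumps _ _ _ in m2.
  have Jle k : k < E -> J k <= E.
    by move=> _; apply: jumps_le.
  apply: (run_core (E := E) (base := base) (M0 := M0) (J := J)) => //.
  - exact: leq_addr.
  - exact: jumps_lassos_at.
  - move=> i v f vX f16 f6; apply: m3; first by rewrite /cell; lia.
    by move=> k kE; rewrite /cell; apply/eqP; lia.
have X1 : 2 ^ E <= (2 ^ E) ^ 6 by rewrite -{1}[2 ^ E]expn1 leq_pexp2l.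
have sG : (size (productions G)).+1 <= grammar_size G.
  rewrite /grammar_size -add1n; apply: leq_add.
    by apply/card_gt0P; exists (start G).
  by rewrite -sum1_size; apply: leq_sum.
have H : 2 ^ E * (size (productions G)).+1 <= (2 ^ E) ^ 6 * grammar_size G by apply: leq_mul.
have bound c d a b k h : a * k <= b * h -> d * a * k + c * b * h <= (c + d) * b * h.
  by move=> le; rewrite !mulnDl addnC leq_add2l -!mulnA leq_mul2l le orbT.
exact: bound H.
Qed.

Theorem theorem6p1 :
  exists (c : prog) (p : {poly nat}) (C : nat),
  forall (S Nt : finType) (P N : seq (lasso S)) (G : grammar S Nt),
    uniq P -> uniq N ->
    let m := size P + size N in
    let n := \max_(l <- P ++ N) lasso_size l in
    exists (s : state) (t : nat) (answer : option (ltl S)),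
      [/\ exec c (initial (encode_instance P N G)) s t,
          t <= C * 2 ^ (p.[(m * n)%N])%R * grammar_size G,
          returns s answer
        & correct_answer P N G answer].
Proof.
(* The polynomial is 36 + 18x = 6 (6 + 3x): [E] is at most 6 + 3mn, and the running time has the
   factor [(2 ^ E) ^ 6]. *)
exists separation_prog, (Poly [:: 36; 18]), (5000 + 5000 + 300) => S Nt P N G _ _ m n.
have [s [t [ex le [answer [ret cor]]]]] := run_separation G P N.
exists s, t, answer; split=> //; apply: leq_trans le _.
rewrite leq_mul2r; apply/orP; right.
rewrite leq_mul2l; apply/orP; right.
rewrite -expnM leq_pexp2l // horner_Poly /=.
(* The two length fields are absorbed because loops are nonempty: |uv| + 2 is at most 3 |uv|. *)
have tot : total_size (P ++ N) <= 3 * (m * n).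
  rewrite /m -size_cat /n /total_size mulnA [3 * _]mulnC -mulnA -sum1_size big_distrl /=.
  rewrite [leqLHS]big_seq [leqRHS]big_seq; apply: leq_sum => l l_in.
  have ln : lasso_size l <= \max_(l <- P ++ N) lasso_size l.
    by rewrite (big_rem l) //= leq_maxl.
  have := loop_size l; move: ln; rewrite /code_size /lasso_size; lia.
have -> : (((0 * (m * n)%N + 18) * (m * n)%N + 36)%R : nat) = 18 * (m * n) + 36 by [].
lia.
Qed.
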